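(* Let $n\ge 4$. For all $2\le k\le\lceil\frac14(n+2)\rceil+\lfloor\frac14(n+2)\rfloor$ the assignments $s'_1\mapsto w_\circ^{[1,n]}$, $s'_2\mapsto w_\circ^{[k,n+1]}$ define a homomorphism of Hecke monoids $(W(B_2),\star)\to(W(D_{n+1}),\star)$. This homomorphism is injective except when $n$ is even and $k=2$, and is parabolic if $k=2$. Moreover, up to diagram automorphisms, all injective and connected homomorphisms of Hecke monoids $\phi:(W(B_2),\star)\to(W(D_{n+1}),\star)$ which are not $\sigma$-invariant are obtained this way.
   Context: For integers $a,b$ write $[a,b]=\{i\in\mathbb Z: a\le i\le b\}$. $B_2$ is the Coxeter matrix over $\{1,2\}$ with $m_{12}=4$. $D_{n+1}$ ($n\ge3$) is the Coxeter matrix over $[1,n+1]$ with $m_{i,i+1}=3$ for $1\le i\le n-1$, $m_{n-1,n+1}=3$, and $m_{ij}=2$ for all other $i\ne j$. For a Coxeter matrix $M=(m_{ij})$ over a finite set $I$, the Hecke monoid $(W(M),\star)$ is generated by $s_i$, $i\in I$, subject to $s_i\star s_i=s_i$ and $s_i\star s_j\star\cdots=s_j\star s_i\star\cdots$ ($m_{ij}$ factors on each side) for $i\neq j$ with $m_{ij}<\infty$; its underlying set is identified with the Coxeter group $W(M)$ (a reduced word being sent to the $\star$-product of its letters). For $J\subset I$, $W_J(M)$ is the subgroup generated by $s_j$, $j\in J$; $\mathscr F(M)$ is the set of $J\subset I$ with $W_J(M)$ finite, and for such $J$, $w_\circ^J$ is the longest element of $W_J(M)$. For $J\subset K\in\mathscr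 F(M)$, $w_{J;K}=w_\circ^Jw_\circ^K$ (product in the Coxeter group). Generators of the domain are denoted $s'_i$. Homomorphisms of monoids preserve identity elements. For a homomorphism of Hecke monoids $\phi:(W(M'),\star)\to(W(M),\star)$, with $M'$ over $I'$ and $M$ over $I$, let $[\phi](i)$ be the support of $\phi(s'_i)$ (the set of indices occurring in a reduced expression) and $[\phi](J)=\bigcup_{j\in J}[\phi](j)$. $\phi$ is: connected if $[\phi](J)$ is a connected subset of $I$ for every connected $J\subset I'$, where a subset is connected if it induces a connected subgraph of the Coxeter graph (vertices $i,j$ joined iff $m_{ij}>2$); parabolic if for each $K'\in\mathscr F(M')$ and each $J'\subset K'$ there exists $J\subset[\phi](K')$ with $\phi(w_{J';K'})=w_{J;[\phi](K')}$. A diagram automorphism is the automorphism $s_i\mapsto s_{\tau(i)}$ induced by a permutation $\tau$ of $I$ with $m_{\tau(i)\tau(j)}=m_{ij}$; ''up to diagram automorphisms'' means up to composition with those of the domain and the codomain. $\sigma$ is the diagram automorphism of $W(D_{n+1})$ given by the transposition $(n,n+1)$; $\phi$ is $\sigma$-invariant if $\sigma([\phi](i))=[\phi](i)$ for all $i$.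
   Formalization: In the ''Moreover'' part, φ is additionally assumed to have full support, [φ]({1,2}) = [1,n+1]; without this the claim fails, e.g. n=5, s'_1 ↦ w_∘^{[2,5]}, s'_2 ↦ w_∘^{[4,6]} is injective, connected, not σ-invariant, but not of the stated form. *)

(* Defs.v *)
From HB Require Import structures.
From mathcomp Require Import all_boot perm all_classical.

Set Implicit Arguments.
Unset Strict Implicit.
Unset Printing Implicit Defensive.

Local Open Scope classical_set_scope.
Local Open Scope quotient_scope.

(* The entry 0 encodes m_ij = oo. *)
Record coxeterMatrix (I : finType) := CoxeterMatrix {
  cox_entry :> I -> I -> nat;
  cox_entry_diag : forall i, cox_entry i i = 1%N;
  cox_entry_sym : forall i j, cox_entry i j = cox_entry j i;
  cox_entry_offdiag : forall i j, i != j -> cox_entry i j != 1%N }.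

Section Presentation.
Variables (I : finType) (R : seq I -> seq I -> Prop).

Inductive congruence : seq I -> seq I -> Prop :=
| CongrRel a b u v of R u v : congruence (a ++ u ++ b) (a ++ v ++ b)
| CongrRefl u : congruence u u
| CongrSym u v of congruence u v : congruence v u
| CongrTrans u v w of congruence u v & congruence v w : congruence u w.

Definition congruenceb (u v : seq I) : bool := `[< congruence u v >].

Lemma congruenceb_refl : reflexive congruenceb.
Proof. by move=> u; apply/asboolP; exact: CongrRefl. Qed.

Lemma congruenceb_sym : symmetric congruenceb.
Proof. by move=> u v; apply/asboolP/asboolP; exact: CongrSym. Qed.

Lemma congruenceb_trans : transitive congruenceb.
Proof.
by move=> v u w /asboolP uv /asboolP vw; apply/asboolP; exact: CongrTrans uv vw.
Qed.

Canonical congruence_equiv :=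
  EquivRel congruenceb congruenceb_refl congruenceb_sym congruenceb_trans.

Definition presented := {eq_quot congruence_equiv}.
HB.instance Definition _ := Choice.on presented.

Definition pclass (w : seq I) : presented := \pi_presented w.
Definition pmul (x y : presented) : presented := pclass (repr x ++ repr y).

Lemma pclassE u v : pclass u = pclass v <-> congruence u v.
Proof.
split; first by move/eqquotP/asboolP.
by move=> uv; apply/eqquotP/asboolP.
Qed.

Lemma pclass_repr x : pclass (repr x) = x.
Proof. exact: reprK. Qed.

Lemma congruence_catl a u v : congruence u v -> congruence (a ++ u) (a ++ v).
Proof.
elim=> {u v} [b c u v uv|u|u v _ uv|u v w _ uv _ vw].
- by have := CongrRel (a ++ b) c uv; rewrite -!catA.
- exact: CongrRefl.
- exact: CongrSym.
- exact: CongrTrans uv vw.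
Qed.

Lemma congruence_catr b u v : congruence u v -> congruence (u ++ b) (v ++ b).
Proof.
elim=> {u v} [a c u v uv|u|u v _ uv|u v w _ uv _ vw].
- by have := CongrRel a (c ++ b) uv; rewrite -!catA.
- exact: CongrRefl.
- exact: CongrSym.
- exact: CongrTrans uv vw.
Qed.

Lemma pmulE u v : pmul (pclass u) (pclass v) = pclass (u ++ v).
Proof.
apply/pclassE/(@CongrTrans _ (u ++ repr (pclass v))).
  by apply/congruence_catr/pclassE; rewrite pclass_repr.
by apply/congruence_catl/pclassE; rewrite pclass_repr.
Qed.

Lemma pmulA : associative pmul.
Proof.
move=> x y z; rewrite -(pclass_repr x) -(pclass_repr y) -(pclass_repr z).
by rewrite !pmulE catA.
Qed.

Lemma pmul1 : left_id (pclass [::]) pmul.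
Proof. by move=> x; rewrite -(pclass_repr x) pmulE. Qed.

Lemma pmulr1 : right_id (pclass [::]) pmul.
Proof. by move=> x; rewrite -(pclass_repr x) pmulE cats0. Qed.

HB.instance Definition _ := isMonoid.Build presented pmulA pmul1 pmulr1.

End Presentation.

Section CoxeterGroup.
Local Open Scope group_scope.
Variables (I : finType) (M : coxeterMatrix I).

(* (s_i s_j)^m_ij = 1; for i = j this is s_i^2 = 1, and it is vacuous when
   m_ij = oo, encoded by 0. *)
Inductive coxeter_rel : seq I -> seq I -> Prop :=
| CoxeterRel i j : coxeter_rel (flatten (nseq (M i j) [:: i; j])) [::].

Definition coxeter := presented coxeter_rel.
HB.instance Definition _ := Monoid.on coxeter.

Definition cclass (w : seq I) : coxeter := pclass coxeter_rel w.
Definition cgen (i : I) : coxeter := cclass [:: i].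

Definition cinv (x : coxeter) : coxeter := cclass (rev (repr x)).

Lemma cclass_rev w : congruence coxeter_rel (rev w ++ w) [::].
Proof.
elim: w => [|i w IHw]; first exact: CongrRefl.
rewrite rev_cons cat_rcons; apply: CongrTrans IHw.
have := CongrRel (rev w) w (CoxeterRel i i).
by rewrite cox_entry_diag.
Qed.

Lemma cmulVg : left_inverse 1 cinv (@mul coxeter).
Proof.
move=> x; rewrite -{2}(pclass_repr x) /cinv.
by rewrite [LHS]pmulE; apply/pclassE/cclass_rev.
Qed.

Lemma cmulgV : right_inverse 1 cinv (@mul coxeter).
Proof.
move=> x; rewrite -{1}(pclass_repr x) /cinv.
rewrite [LHS]pmulE; apply/pclassE.
by rewrite -{1}(revK (repr x)); apply: cclass_rev.
Qed.

HB.instance Definition _ := hasInv.Build coxeter cinv.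
HB.instance Definition _ := Monoid_isGroup.Build coxeter cmulVg cmulgV.

Lemma ex_clength (x : coxeter) :
  exists l, `[< exists w, cclass w = x /\ size w = l >].
Proof.
by exists (size (repr x)); apply/asboolP; exists (repr x); rewrite [LHS]pclass_repr.
Qed.

Definition clength (x : coxeter) : nat := ex_minn (ex_clength x).

Definition reduced (w : seq I) : Prop := size w = clength (cclass w).

Definition is_subgroup (S : set coxeter) : Prop :=
  S 1 /\ forall x y, S x -> S y -> S (x * y^-1).

Definition parabolic_subgroup (J : {set I}) : set coxeter :=
  smallest is_subgroup (cgen @` [set` J]).

(* J is spherical when it belongs to F(M). *)
Definition spherical (J : {set I}) : Prop := finite_set (parabolic_subgroup J).

Definition is_longest (J : {set I}) (x : coxeter) : Prop :=
  parabolic_subgroup J x /\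
  forall y, parabolic_subgroup J y -> clength y <= clength x.

(* The longest element of W_J; only meaningful for spherical J. *)
Definition w0 (J : {set I}) : coxeter := xget 1 (is_longest J).

Definition wpair (J K : {set I}) : coxeter := w0 J * w0 K.

End CoxeterGroup.

Section HeckeMonoid.
Variables (I : finType) (M : coxeterMatrix I).

(* The word i j i j ... with m letters. *)
Definition alternating (i j : I) (m : nat) : seq I :=
  mkseq (fun k => if odd k then j else i) m.

Inductive hecke_rel : seq I -> seq I -> Prop :=
| HeckeIdem i : hecke_rel [:: i; i] [:: i]
| HeckeBraid i j of i != j & M i j != 0%N :
    hecke_rel (alternating i j (M i j)) (alternating j i (M i j)).

Definition hecke := presented hecke_rel.
HB.instance Definition _ := Monoid.on hecke.

Definition hclass (w : seq I) : hecke := pclass hecke_rel w.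
Definition hgen (i : I) : hecke := hclass [:: i].

(* The identification of the underlying sets of the Coxeter group and of the
   Hecke monoid: the product of the letters of a reduced word of x in the
   Coxeter group is sent to their product in the Hecke monoid. The choice of
   the reduced word is immaterial by Matsumoto's theorem. *)
Definition to_hecke (x : coxeter M) : hecke :=
  hclass (xget [::] [set w | cclass M w = x /\ reduced M w]).

Definition hecke_support (h : hecke) : {set I} :=
  [set i | `[< exists w, [/\ reduced M w, hclass w = h & i \in w] >]]%SET.

Definition cox_adj : rel I := [rel i j | (M i j == 0%N) || (2 < M i j)].

(* The empty set counts as connected. *)
Definition connected_subset (J : {set I}) : Prop :=
  {in J &, forall i j,
    connect [rel x y | [&& x \in J, y \in J & cox_adj x y]] i j}.

Definition is_diagram_perm (tau : {perm I}) : Prop :=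
  forall i j, M (tau i) (tau j) = M i j.

Definition is_diagram_automorphism (theta : hecke -> hecke) : Prop :=
  monoid_morphism theta /\
  exists2 tau : {perm I}, is_diagram_perm tau &
    forall i, theta (hgen i) = hgen (tau i).

End HeckeMonoid.

Section HeckeHomomorphism.
Variables (I' I : finType) (M' : coxeterMatrix I') (M : coxeterMatrix I).
Variable phi : hecke M' -> hecke M.

Definition hsupp (i : I') : {set I} := hecke_support (phi (hgen M' i)).
Definition hsupps (J : {set I'}) : {set I} := (\bigcup_(j in J) hsupp j)%SET.

Definition hecke_connected : Prop :=
  forall J : {set I'}, connected_subset M' J -> connected_subset M (hsupps J).

(* Sphericity of hsupps K', implicit in w_{J;K} being defined, is stated
   explicitly because w0 is total. *)
Definition hecke_parabolic : Prop :=
  forall K' : {set I'}, spherical M' K' ->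
    spherical M (hsupps K') /\
    forall J' : {set I'}, J' \subset K' ->
      exists2 J : {set I}, J \subset hsupps K' &
        phi (to_hecke (wpair M' J' K')) = to_hecke (wpair M J (hsupps K')).

(* The classification of the homomorphisms out of the Hecke monoid of B_2 needs
   this hypothesis: a homomorphism into the Hecke monoid of a proper parabolic
   subgroup of type D_{m+1}, m < n, composed with the inclusion, is again
   injective, connected and not sigma-invariant. *)
Definition fully_supported : Prop := hsupps [set: I']%SET = [set: I]%SET.

End HeckeHomomorphism.

(* The ordinal i : 'I_N stands for the index i + 1 of [1, N]. *)
Definition interval (N a b : nat) : {set 'I_N} :=
  [set i : 'I_N | a <= i.+1 <= b]%SET.

Definition B2_entry (i j : 'I_2) : nat := if i == j then 1 else 4.

Lemma B2_entry_diag i : B2_entry i i = 1%N.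
Proof. by rewrite /B2_entry eqxx. Qed.

Lemma B2_entry_sym i j : B2_entry i j = B2_entry j i.
Proof. by rewrite /B2_entry eq_sym. Qed.

Lemma B2_entry_offdiag i j : i != j -> B2_entry i j != 1%N.
Proof. by rewrite /B2_entry => /negPf->. Qed.

Definition B2 : coxeterMatrix 'I_2 :=
  CoxeterMatrix B2_entry_diag B2_entry_sym B2_entry_offdiag.

(* Edges of the Coxeter graph, oriented towards the larger index; a and b are
   elements of [1, n + 1]. *)
Definition D_edge (n a b : nat) : bool :=
  (a <= n.-1) && (b == a.+1) || (a == n.-1) && (b == n.+1).

Definition D_entry (n : nat) (i j : 'I_n.+1) : nat :=
  if i == j then 1
  else if D_edge n i.+1 j.+1 || D_edge n j.+1 i.+1 then 3 else 2.

Lemma D_entry_diag n i : @D_entry n i i = 1%N.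
Proof. by rewrite /D_entry eqxx. Qed.

Lemma D_entry_sym n i j : @D_entry n i j = @D_entry n j i.
Proof. by rewrite /D_entry eq_sym orbC. Qed.

Lemma D_entry_offdiag n i j : i != j -> @D_entry n i j != 1%N.
Proof. by rewrite /D_entry => /negPf->; case: ifP. Qed.

(* D n is the matrix D_{n+1}, of rank n + 1; it is only used for n >= 3. *)
Definition D (n : nat) : coxeterMatrix 'I_n.+1 :=
  CoxeterMatrix (@D_entry_diag n) (@D_entry_sym n) (@D_entry_offdiag n).

(* The transposition (n, n + 1) of the indices. *)
Definition D_sigma (n : nat) : {perm 'I_n.+1} := tperm (inord n.-1) ord_max.

Definition sigma_invariant (I' : finType) (M' : coxeterMatrix I') (n : nat)
    (phi : hecke M' -> hecke (D n)) : Prop :=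
  forall i, (D_sigma n @: hsupp phi i)%SET = hsupp phi i.

Definition ceil_divn (m d : nat) : nat := (m + d.-1) %/ d.

Definition admissible (n k : nat) : bool :=
  2 <= k <= ceil_divn n.+2 4 + n.+2 %/ 4.

Definition is_B2_D_hom (n k : nat) (phi : hecke B2 -> hecke (D n)) : Prop :=
  [/\ monoid_morphism phi,
      phi (hgen B2 ord0) = to_hecke (w0 (D n) (interval n.+1 1 n)) &
      phi (hgen B2 ord_max) = to_hecke (w0 (D n) (interval n.+1 k n.+1))].

(* Main.v *)
(* A homomorphism from the Hecke monoid of B_2 is given by idempotents e, f with
   efef = fefe. Idempotents of a finite Hecke monoid are the longest elements of
   parabolic subgroups W_A, W_B, and this relation forces both sides to be the
   longest element of W_(A u B). Elements of W(D_(n+1)) are signed permutations;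
   when A = [1, n], whether fefe is the longest element only depends on the
   positions of the negative coordinates. Multiplication by e sorts them to the
   front, and multiplication by f, for B = [k, n+1], makes the last n+2-k
   coordinates negative, up to one for parity. So fefe is the longest element if
   and only if k - 1 <= 2 floor((n+2-k)/2), and efe is if and only if n is even
   and k = 2. If instead B is contained in [1, n-1] u {n+1}, each factor adds at
   most two negative coordinates and fefe is never the longest element; together
   with connectedness this leaves only B = [k, n+1] and A = [1, n]. *)

From HB Require Import structures.
Require Import Defs.
From mathcomp Require Import fingroup all_boot perm all_classical.
From mathcomp Require Import zify.

Set Implicit Arguments.
Unset Strict Implicit.
Unset Printing Implicit Defensive.

Local Open Scope group_scope.

(** Words, supports and longest elements are compared in two presented monoids, so both Coxeter
    groups need a faithful model: a finite group with descent predicates subject to exchange, on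
    which the Hecke monoid acts. A longest element is handled as the zero of its parabolic
    submonoid. Zeros are unique and fixed by word reversal, so equality with a longest element
    becomes a test of descents, and [efef = fefe] follows once [fefe] is a zero. Injectivity only
    asks that [efe] and [fef] differ from the longest element, since left multiplication carries any
    collision in B2 to one between the top and a coatom; [fef] always differs, as it never sends the
    first basis vector to its opposite. For k = 2, parabolicity holds because [fef] lies one
    generator, [s_1], below the longest element, and so does [efe] with [s_(n+1)] when n is odd. The
    bound n >= 4 enters when [B] is contained in [1, n-1] u {n+1}: there [fefe] has at most three
    negative coordinates among the first n. *)

Section Congruence.
Variable I : finType.
Implicit Types (R : seq I -> seq I -> Prop) (u v w : seq I).

Lemma congruence_sub R R' u v :
  (forall u v, R u v -> congruence R' u v) ->
  congruence R u v -> congruence R' u v.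
Proof.
move=> sRR'; elim=> {u v} [a b u v /sRR' uv|u|u v _ uv|u v w _ uv _ vw].
- exact/congruence_catl/congruence_catr.
- exact: CongrRefl.
- exact: CongrSym.
- exact: CongrTrans uv vw.
Qed.

Lemma congruence_invariant R T (f : seq I -> T) u v :
  (forall a b u v, R u v -> f (a ++ u ++ b) = f (a ++ v ++ b)) ->
  congruence R u v -> f u = f v.
Proof. by move=> Rf; elim=> {u v} [a b u v /Rf|//|//|u v w _ -> _ ->]. Qed.

Lemma congruence_rev R u v :
  (forall u v, R u v -> congruence R (rev u) (rev v)) ->
  congruence R u v -> congruence R (rev u) (rev v).
Proof.
move=> Rr; elim=> {u v} [a b u v /Rr uv|u|u v _ uv|u v w _ uv _ vw].
- rewrite !rev_cat -!catA.
  by apply: congruence_catl; apply: congruence_catr.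
- exact: CongrRefl.
- exact: CongrSym.
- exact: CongrTrans uv vw.
Qed.

Lemma alternatingS (i j : I) m : alternating i j m.+1 = i :: alternating j i m.
Proof.
rewrite /alternating /mkseq /= -[1%N]addn0 iotaDl -map_comp; congr cons.
by apply: eq_map => k /=; case: (odd k).
Qed.

Lemma size_alternating (i j : I) m : size (alternating i j m) = m.
Proof. by rewrite size_mkseq. Qed.

(** Reversal keeps each side of a braid relation or swaps the two, according to the parity of [m];
    hence it respects the Hecke relations. *)
Lemma rev_alternating (i j : I) m :
  rev (alternating i j m) =
  if odd m then alternating i j m else alternating j i m.
Proof.
apply: (@eq_from_nth _ i) => [|k]; rewrite size_rev size_alternating.
  by case: ifP; rewrite size_alternating.
move=> ltkm; rewrite nth_rev size_alternating // nth_mkseq; last by lia.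
have -> : odd (m - k.+1) = odd m (+) ~~ odd k by rewrite oddB.
by case: (odd m); rewrite nth_mkseq //; case: (odd k).
Qed.

Lemma mem_alternating (i j : I) m :
  1 < m -> alternating i j m =i [:: i; j].
Proof.
case: m => [|[|m]] // _ k; rewrite !alternatingS !inE.
suff: k \in alternating i j m -> (k == i) || (k == j).
  by move=> km; case: eqP => //= ki; case: eqP => //= kj; apply/negP=> /km;
     case/orP=> /eqP.
by case/mapP=> l _ ->; case: ifP; rewrite eqxx ?orbT.
Qed.

End Congruence.

(** * Zeros of parabolic submonoids *)

Section HeckeGeneral.
Variables (I : finType) (M : coxeterMatrix I).
Implicit Types (u v w : seq I) (i j : I) (J K : {set I}) (h z : hecke M).

Lemma hclassM u v : hclass M u * hclass M v = hclass M (u ++ v).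
Proof. exact: pmulE. Qed.

Lemma hclass1 : hclass M [::] = 1.
Proof. by []. Qed.

Lemma hclassE (h : hecke M) : hclass M (repr h) = h.
Proof. exact: pclass_repr. Qed.

Lemma hgen_idem i : hgen M i * hgen M i = hgen M i.
Proof.
rewrite hclassM; apply/pclassE.
by have := CongrRel [::] [::] (HeckeIdem M i); rewrite !cats0.
Qed.

Lemma hclass_rev u v :
  hclass M u = hclass M v -> hclass M (rev u) = hclass M (rev v).
Proof.
move=> /pclassE uv; apply/pclassE.
apply: congruence_rev uv => {}u {}v [i|i j neq_ij Mij].
  by have := CongrRel [::] [::] (HeckeIdem M i); rewrite !cats0.
rewrite !rev_alternating.
have := CongrRel [::] [::] (HeckeBraid neq_ij Mij); rewrite !cats0 /=.
by case: (odd _) => //; apply: CongrSym.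
Qed.

(** Both Hecke relations preserve the set of letters; for the braid relation this uses that an
    off-diagonal entry is not 1. *)
Lemma hclass_mem u v : hclass M u = hclass M v -> u =i v.
Proof.
move=> /pclassE uv k; move: uv.
apply: (congruence_invariant (f := fun u => k \in u)).
move=> a b {}u {}v uv; rewrite !mem_cat; congr (_ || (_ || _)).
case: uv => [i|i j neq_ij Mij]; first by rewrite !inE orbb.
have gt1M : 1 < M i j by have := cox_entry_offdiag M neq_ij; lia.
by rewrite !mem_alternating // !inE orbC.
Qed.

Definition hsub (J : {set I}) (h : hecke M) : Prop :=
  exists2 w, {subset w <= J} & hclass M w = h.

(** A zero of the parabolic submonoid on [J]. In a descent model it is the longest element of [W_J],
    by [hzero_w0]. *)
Definition hzero (J : {set I}) (h : hecke M) : Prop :=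
  hsub J h /\ forall i, i \in J -> hgen M i * h = h /\ h * hgen M i = h.

Lemma hzero_mul J z h : hzero J z -> hsub J h -> h * z = z /\ z * h = z.
Proof.
move=> [_ zJ] [w + <-]; elim: w => [|i w IHw] sw.
  by rewrite hclass1 mul1g mulg1.
have [iz zi] := zJ i (sw i (mem_head i w)).
have [|wz zw] := IHw; first by move=> j jw; apply: sw; rewrite inE jw orbT.
rewrite -cat1s -hclassM -/(hgen M i).
by rewrite -mulgA wz iz mulgA zi zw.
Qed.

Lemma hzero_uniq J z z' : hzero J z -> hzero J z' -> z = z'.
Proof.
move=> zJ z'J; have [_ <-] := hzero_mul zJ (proj1 z'J).
by have [-> _] := hzero_mul z'J (proj1 zJ).
Qed.

Lemma hsub1 J : hsub J 1.
Proof. by exists [::]. Qed.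

Lemma hsubM J h h' : hsub J h -> hsub J h' -> hsub J (h * h').
Proof.
move=> [u su <-] [v sv <-]; exists (u ++ v); last by rewrite hclassM.
by move=> k; rewrite mem_cat => /orP[/su|/sv].
Qed.

Lemma hsub_gen J i : i \in J -> hsub J (hgen M i).
Proof. by move=> iJ; exists [:: i] => // k; rewrite inE => /eqP->. Qed.

Lemma hsub_setT h : hsub [set: I] h.
Proof. by exists (repr h); [move=> k; rewrite inE | apply: hclassE]. Qed.

Lemma hsub_subset (J K : {set I}) h : J \subset K -> hsub J h -> hsub K h.
Proof.
by move=> /fintype.subsetP sJK [w sw wh]; exists w => // k kw; apply/sJK/sw.
Qed.

(* Reversing words turns a left zero into a right zero. *)
Lemma hzero_left J h :
  hsub J h -> (forall i, i \in J -> hgen M i * h = h) -> hzero J h.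
Proof.
move=> [w sw wh] hl.
have abs u : {subset u <= J} -> hclass M u * h = h.
  elim: u => [|i u IHu] su; first by rewrite hclass1 mul1g.
  rewrite -cat1s -hclassM -mulgA IHu ?hl //.
    by apply: su; rewrite mem_head.
  by move=> k ku; apply: su; rewrite inE ku orbT.
have sr : {subset rev w <= J} by move=> k; rewrite mem_rev => /sw.
have rr : hclass M (rev w) = h.
  have rww : hclass M (rev w ++ w) = hclass M w by rewrite -hclassM wh abs.
  by rewrite -wh -rww; have := hclass_rev rww; rewrite rev_cat revK.
split; first by exists w.
move=> i iJ; split; first exact: hl.
have irw : hclass M (i :: rev w) = hclass M (rev w).
  by rewrite -cat1s -hclassM rr; apply: hl.
by have := hclass_rev irw; rewrite rev_cons revK -cats1 -hclassM wh.
Qed.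

(** Reversal is an anti-automorphism fixing the generators, so it takes a zero to a zero, and zeros
    are unique. *)
Lemma hzero_rev J w : hzero J (hclass M w) -> hclass M (rev w) = hclass M w.
Proof.
move=> wJ; apply: (hzero_uniq _ wJ); apply: hzero_left.
  have [[v sv /hclass_mem vw] _] := wJ.
  by exists (rev w) => // k; rewrite mem_rev -vw => /sv.
move=> i /(proj2 wJ)[_]; rewrite hclassM => /hclass_rev.
by rewrite rev_cat hclassM.
Qed.

End HeckeGeneral.

(** * Coxeter groups and Hecke monoids from descents *)

Section WordValue.
Variables (I : finType) (N : monoidType) (g : I -> N).
Implicit Types (u v w : seq I) (i j : I).

Definition wordval w : N := foldr (fun i x => g i * x) 1 w.

Lemma wordval_cat u v : wordval (u ++ v) = wordval u * wordval v.
Proof. by elim: u => [|i u IHu] /=; rewrite ?mul1g // IHu mulgA. Qed.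

Lemma wordval_rcons u i : wordval (rcons u i) = wordval u * g i.
Proof. by rewrite -cats1 wordval_cat /= mulg1. Qed.

Lemma wordval_nseq u m : wordval (flatten (nseq m u)) = wordval u ^+ m.
Proof. by elim: m => [|m IHm] //=; rewrite wordval_cat IHm expgS. Qed.

End WordValue.

Section GroupWordValue.
Variables (I : finType) (G : groupType) (g : I -> G).
Implicit Types (u v w : seq I) (i j : I).

Local Notation wordval := (wordval g).

Hypothesis gen_sqr : forall i, g i * g i = 1.

Lemma wordval_rev w : wordval (rev w) = (wordval w)^-1.
Proof.
elim: w => [|i w IHw]; first by rewrite invg1.
by rewrite rev_cons wordval_rcons IHw /= invgM (mulg1_eq (gen_sqr i)).
Qed.

(** Cut the alternating word of length [2m], whose value is 1, in the middle: the second half is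
    inverse to the first, hence has the value of the reversed first half. *)
Lemma wordval_alternating i j m : (g i * g j) ^+ m = 1 ->
  wordval (alternating i j m) = wordval (alternating j i m).
Proof.
have altE p (k l : I) : wordval (alternating k l p.*2) = (g k * g l) ^+ p.
  elim: p => [|p IHp] //.
  by rewrite doubleS !alternatingS /= IHp mulgA expgS.
have alt_cat p q (k l : I) : alternating k l (p + q) =
    alternating k l p ++
    (if odd p then alternating l k q else alternating k l q).
  elim: p k l => [|p IHp] k l //.
  by rewrite addSn !alternatingS IHp /=; case: (odd p).
rewrite -altE -addnn alt_cat wordval_cat => /mulg1_eq.
rewrite -wordval_rev rev_alternating.
by case: (odd m).
Qed.

End GroupWordValue.

(** * Exchange condition and reduced words in a descent model *)

Section DescentModel.
Variables (I : finType) (M : coxeterMatrix I) (G : finGroupType) (g : I -> G).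
Variable D : I -> G -> bool.
Implicit Types (u v w r : seq I) (i j : I) (J K : {set I}) (h : hecke M).

Local Notation evw := (wordval g).

(* The conditions of Bourbaki, Lie IV.1.7, Prop. 6, for the complements of the
   sets P_s: [D i x] says that [i] is a left descent of [x]. The last one forces the order of [g i * g j] to be exactly [M i j]. *)
Record descent_model : Prop := DescentModel {
  dm_fin : forall i j, M i j != 0;
  dm_rel : forall i j, (g i * g j) ^+ M i j = 1;
  dm_one : forall i, ~~ D i 1;
  dm_flip : forall i w, D i (g i * evw w) = ~~ D i (evw w);
  dm_exch : forall i j w,
    D i (evw w * g j) != D i (evw w) -> g i * evw w = evw w * g j;
  dm_alt : forall i j m, i != j -> m < M i j -> ~~ D i (evw (alternating j i m)) }.

Hypothesis mod : descent_model.

Lemma gen_sqr i : g i * g i = 1.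
Proof. by have := dm_rel mod i i; rewrite cox_entry_diag expg1. Qed.

Lemma gen_mulK i x : g i * (g i * x) = x.
Proof. by rewrite mulgA gen_sqr mul1g. Qed.

(** Minimality is measured in the model [G]; [reducedP] matches it with reducedness in the presented
    group. *)
Definition greduced w := forall v, evw v = evw w -> size w <= size v.

(** The letter to delete is the one at which [i] becomes a descent of the growing prefix. The fixed
    part [u] lets [alternating_prefix] keep the deletion out of a chosen beginning of the word. *)
Lemma exchange_cat i u w : D i (evw (u ++ w)) ->
  D i (evw u) \/
  exists a j b, w = a ++ j :: b /\ evw (u ++ w) = evw (i :: u ++ a ++ b).
Proof.
elim/last_ind: w => [|w j IHw]; first by rewrite cats0; left.
rewrite -rcons_cat wordval_rcons => Di.
case: (boolP (D i (evw (u ++ w)))) => [/IHw [|[a [k [b [-> ev]]]]]|nDi].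
- by left.
- right; exists a, k, (rcons b j); rewrite rcons_cat rcons_cons; split => //.
  by rewrite ev -rcons_cat -rcons_cat /= wordval_rcons mulgA.
- right; exists w, j, [::]; rewrite cats1 cats0; split => //=.
  by symmetry; apply: (dm_exch mod); rewrite Di.
Qed.

Lemma exchange i w : D i (evw w) ->
  exists a j b, w = a ++ j :: b /\ evw w = evw (i :: a ++ b).
Proof.
by case/(@exchange_cat i [::]) => //; rewrite (negPf (dm_one mod i)).
Qed.

Lemma greduced_descent i w : D i (evw w) -> ~ greduced (i :: w).
Proof.
move=> /exchange[a [j [b [-> /= ev]]]] /(_ (a ++ b)).
by rewrite /= ev gen_mulK !size_cat /= => /(_ erefl); lia.
Qed.

Lemma greduced_cons i w : greduced w -> ~~ D i (evw w) -> greduced (i :: w).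
Proof.
move=> rw nDi u eu; rewrite leqNgt; apply/negP => ltu.
have Du : D i (evw u) by rewrite eu /= (dm_flip mod).
have [a [j [b [def_u eu']]]] := exchange Du.
have := rw (a ++ b); rewrite -[evw (a ++ b)](gen_mulK i).
rewrite -[g i * evw (a ++ b)]/(evw (i :: a ++ b)) -eu' eu /= gen_mulK.
by move=> /(_ erefl); move: ltu; rewrite def_u !size_cat /=; lia.
Qed.

Lemma greduced_behead i w : greduced (i :: w) -> greduced w.
Proof. by move=> rw u eu; apply: (rw (i :: u)); rewrite /= eu. Qed.

Lemma greduced_ascent i w : greduced (i :: w) -> ~~ D i (evw w).
Proof. by move=> rw; apply/negP=> /greduced_descent. Qed.

Lemma greduced_rev w : greduced w -> greduced (rev w).
Proof.
move=> rw u eu; rewrite size_rev -(size_rev u); apply: rw.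
by rewrite (wordval_rev gen_sqr) eu (wordval_rev gen_sqr) invgK.
Qed.

Lemma greduced_nil : greduced [::].
Proof. by []. Qed.

Lemma greduced_eq u v :
  greduced u -> evw v = evw u -> size v <= size u -> greduced v.
Proof. by move=> ru evu svu w; rewrite evu => /ru; lia. Qed.

Lemma greduced_size u v :
  greduced u -> greduced v -> evw u = evw v -> size u = size v.
Proof.
by move=> ru rv euv; apply/eqP; rewrite eqn_leq ru ?rv // euv.
Qed.

Lemma descent_word i w : greduced w -> D i (evw w) ->
  exists v, [/\ greduced (i :: v), evw (i :: v) = evw w & {subset v <= w}].
Proof.
move=> rw /exchange[a [j [b [def_w ew]]]]; exists (a ++ b); split => //.
  apply: (greduced_eq rw); first by rewrite ew.
  by rewrite def_w /= !size_cat /=; lia.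
by move=> k; rewrite def_w !mem_cat inE => /orP[]->; rewrite ?orbT.
Qed.

(** * Matsumoto's theorem *)

Inductive braid_rel : seq I -> seq I -> Prop :=
  BraidRel i j of i != j :
    braid_rel (alternating i j (M i j)) (alternating j i (M i j)).

Lemma alternating_prefix i j w m : i != j -> greduced w ->
  D i (evw w) -> D j (evw w) -> m <= M i j ->
  (exists2 y, evw (alternating i j m ++ y) = evw w & size y + m = size w) /\
  (exists2 y, evw (alternating j i m ++ y) = evw w & size y + m = size w).
Proof.
move=> neq_ij rw Di Dj.
have step k l p : k != l -> D k (evw w) -> p < M k l ->
    (exists2 y, evw (alternating l k p ++ y) = evw w & size y + p = size w) ->
    exists2 y, evw (alternating k l p.+1 ++ y) = evw w & size y + p.+1 = size w.
  move=> neq_kl Dk ltp [y ey sy]; move: Dk; rewrite -ey.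
  case/exchange_cat=> [|[a [q [b [def_y e]]]]].
    by rewrite (negPf (dm_alt mod neq_kl ltp)).
  exists (a ++ b); first by rewrite alternatingS e.
  by rewrite -sy def_y !size_cat /=; lia.
elim: m => [|m IHm] lem; first by split; exists w; rewrite ?addn0.
have [Hi Hj] := IHm (ltnW lem); split; first exact: step Hj.
by apply: step Hi; rewrite // 1?eq_sym // cox_entry_sym.
Qed.

(** Words with different first letters [i] and [j] are joined through two words beginning with the
    two sides of the braid relation; each remaining comparison has a common first letter, where
    induction on the length applies. *)
Theorem matsumoto u v : greduced u -> greduced v -> evw u = evw v ->
  congruence braid_rel u v.
Proof.
have [n] := ubnP (size u); elim: n u v => // n IHn [|i u] v /= ltun ru rv euv.
  have /eqP := greduced_size rv ru (esym euv).
  by rewrite /= => /nilP->; apply: CongrRefl.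
case: v => [|j v] in rv euv *; first by have := greduced_size ru rv euv.
have same k x y : size x < n -> greduced (k :: x) -> greduced (k :: y) ->
    evw (k :: x) = evw (k :: y) -> congruence braid_rel (k :: x) (k :: y).
  move=> ltxn rx ry /mulgI exy; apply: (@congruence_catl _ _ [:: k]).
  by apply: IHn => //; [apply: greduced_behead rx | apply: greduced_behead ry].
have [eq_ij|neq_ij] := eqVneq i j.
  by rewrite -eq_ij in rv euv *; apply: same => //; lia.
have Di : D i (evw (i :: u)) by rewrite /= (dm_flip mod) greduced_ascent.
have Dj : D j (evw (i :: u)).
  by rewrite [evw _]euv /= (dm_flip mod) greduced_ascent.
have [[y ey sy] _] := alternating_prefix neq_ij ru Di Dj (leqnn (M i j)).
have := dm_fin mod i j; case def_m: (M i j) => [|m] // _.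
rewrite def_m in ey sy; rewrite /= in sy.
have ey' : evw (alternating j i m.+1 ++ y) = evw (i :: u).
  have e := wordval_alternating gen_sqr (dm_rel mod i j).
  by rewrite wordval_cat -def_m -e def_m -wordval_cat.
have szuv := greduced_size ru rv euv; rewrite /= in szuv.
apply: (@CongrTrans _ _ _ (alternating i j m.+1 ++ y)).
  rewrite alternatingS in ey *.
  apply: (same i u (alternating j i m ++ y)) => //.
  by apply: (greduced_eq ru ey); rewrite /= size_cat size_alternating; lia.
apply: (@CongrTrans _ _ _ (alternating j i m.+1 ++ y)).
  have := CongrRel [::] y (BraidRel neq_ij).
  by rewrite def_m.
rewrite alternatingS in ey' *; apply: (same j (alternating i j m ++ y) v).
- by rewrite size_cat size_alternating; lia.
- by apply: (greduced_eq ru ey'); rewrite /= size_cat size_alternating; lia.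
- exact: rv.
- by rewrite ey' [LHS]euv.
Qed.

(** * Comparison with the presented Coxeter group *)

Lemma cgenK i : congruence (coxeter_rel M) [:: i; i] [::].
Proof.
by have := CongrRel [::] [::] (CoxeterRel M i i); rewrite cox_entry_diag.
Qed.

Lemma hclass_braid u v : congruence braid_rel u v -> hclass M u = hclass M v.
Proof.
move=> uv; apply/pclassE; apply: congruence_sub uv => _ _ [i j neq_ij].
have := CongrRel [::] [::] (HeckeBraid neq_ij (dm_fin mod i j)).
by rewrite !cats0.
Qed.

Lemma cgen_sqr i : cgen M i * cgen M i = 1.
Proof. by rewrite [LHS]pmulE; apply/pclassE/cgenK. Qed.

Lemma cclassM u v : cclass M u * cclass M v = cclass M (u ++ v).
Proof. exact: pmulE. Qed.

Lemma cclass_wordval w : cclass M w = wordval (cgen M) w.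
Proof. by elim: w => [|i w IHw] //=; rewrite -IHw -[i :: w]cat1s -cclassM. Qed.

Lemma cclass_braid u v : congruence braid_rel u v -> cclass M u = cclass M v.
Proof.
apply: congruence_invariant => a b _ _ [i j _].
rewrite !cclass_wordval !wordval_cat; congr (_ * (_ * _)).
apply: (wordval_alternating cgen_sqr).
have := CongrRel [::] [::] (CoxeterRel M i j); rewrite cats0 /=.
by move/pclassE; rewrite -/(cclass _ _) cclass_wordval wordval_nseq /= mulg1.
Qed.

(** When the new letter [i] is already a descent, Matsumoto's theorem lets the reduced word start
    with [i], which then cancels. *)
Lemma reduced_word w : exists r,
  [/\ greduced r, {subset r <= w}, evw r = evw w & cclass M r = cclass M w].
Proof.
elim: w => [|i w [r [rr sr er cr]]]; first by exists [::]; split.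
have sirw : {subset i :: r <= i :: w}.
  by move=> k; rewrite !inE => /orP[->//|/sr->]; rewrite orbT.
have [/(descent_word rr)[v [rv ev sv]]|nDi] := boolP (D i (evw r)).
  exists v; split.
  - exact: greduced_behead rv.
  - by move=> k /sv kr; apply: sirw; rewrite inE kr orbT.
  - by rewrite /= -er -ev /= gen_mulK.
  - have := cclass_braid (matsumoto rv rr ev).
    rewrite -[i :: v]cat1s -[i :: w]cat1s -!cclassM cr => <-.
    by rewrite mulgA cgen_sqr mul1g.
exists (i :: r); split => //; first exact: greduced_cons.
  by rewrite /= er.
by rewrite -[i :: r]cat1s -[i :: w]cat1s -!cclassM cr.
Qed.

(** Faithfulness of the model: words with the same value reduce to words that differ by braid moves
    alone. *)
Lemma cclassP u v : cclass M u = cclass M v <-> evw u = evw v.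
Proof.
split=> [/pclassE|euv].
  apply: congruence_invariant => a b _ _ [i j].
  by rewrite !wordval_cat wordval_nseq /= mulg1 (dm_rel mod) mul1g.
have [r [rr _ er <-]] := reduced_word u; have [s [rs _ es <-]] := reduced_word v.
by apply/cclass_braid/matsumoto; rewrite // er es.
Qed.

Lemma reducedP w : reduced M w <-> greduced w.
Proof.
rewrite /reduced /clength; case: ex_minnP => l /asboolP[v [/cclassP ev <-]] lmin.
split=> [ew u eu|/(_ v ev) wv].
  by rewrite ew; apply: lmin; apply/asboolP; exists u; split => //; apply/cclassP.
by apply/eqP; rewrite eqn_leq wv lmin //; apply/asboolP; exists w.
Qed.

(** * The Hecke monoid acting on the model *)

Lemma greduced_alternating i j m :
  i != j -> m <= M i j -> greduced (alternating i j m).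
Proof.
elim: m i j => [|m IHm] i j neq_ij lem //; rewrite alternatingS.
apply: greduced_cons; last exact: (dm_alt mod).
by apply: IHm; [rewrite eq_sym | rewrite cox_entry_sym ltnW].
Qed.

(** The Demazure product with a generator, as an operator on [G]: the longer of [x] and [g i * x].
    Right descents of [x] are read off [x^-1]. *)
Definition lstar i (x : G) := if D i x then x else g i * x.
Definition rstar j (x : G) := if D j x^-1 then x else x * g j.
Definition lstarw w (x : G) := foldr lstar x w.

Lemma lstar_word i w : exists v, lstar i (evw w) = evw v.
Proof. by rewrite /lstar; case: ifP; [exists w | exists (i :: w)]. Qed.

Lemma lstarw_word u w : exists v, lstarw u (evw w) = evw v.
Proof.
elim: u => [|i u [v /= ->]]; [by exists w | exact: lstar_word].
Qed.

(** If right multiplication by [g j] changes the status of [i], exchange gives [g i * x = x * g j]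
    and the two operators agree at [x]; otherwise neither multiplication affects the descent tested
    by the other operator. *)
Lemma lstar_rstar i j w : lstar i (rstar j (evw w)) = rstar j (lstar i (evw w)).
Proof.
have [r [rr _ <- _]] := reduced_word w.
have gV k : (g k)^-1 = g k by rewrite (mulg1_eq (gen_sqr k)).
set x := evw r; have xV : x^-1 = evw (rev r) by rewrite (wordval_rev gen_sqr).
have DxV k : D k ((g j)^-1 * x^-1) = D k (g j * evw (rev r)) by rewrite gV xV.
rewrite /lstar /rstar.
have [eD|nD] := eqVneq (D i (x * g j)) (D i x); last first.
  have comm : g i * x = x * g j by apply: (dm_exch mod).
  (* Prepending [i] and appending [j] give words of one value and one length, so they are reduced
     together. *)
  have eq_desc : D i x = D j x^-1.
    have eir : evw (i :: r) = evw (rcons r j) by rewrite /= wordval_rcons.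
    have rrc : greduced (rcons r j) <-> ~~ D j (evw (rev r)).
      split=> [/greduced_rev|nDj]; first by rewrite rev_rcons => /greduced_ascent.
      rewrite -[rcons r j]revK rev_rcons; apply: greduced_rev.
      by apply: greduced_cons => //; apply: greduced_rev.
    rewrite xV; apply/idP/idP; apply: contraLR; [move=> /rrc rj | move=> nDi].
      by apply: greduced_ascent; apply: (greduced_eq rj); rewrite ?size_rcons.
    apply/rrc; apply: (greduced_eq (greduced_cons rr nDi)) => //.
    by rewrite size_rcons.
  have DiR : D i (x * g j) = ~~ D i x by rewrite -comm (dm_flip mod).
  have DjL : D j (g i * x)^-1 = ~~ D j x^-1.
    by rewrite comm invgM gV xV (dm_flip mod).
  rewrite -eq_desc in DjL *; have [Di|nDi] := boolP (D i x).
    by rewrite Di -eq_desc Di.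
  by rewrite DiR DjL nDi.
(* A change in the status of [j] would give [x * g j = g i * x] by exchange for [x^-1]; this flips
   the status of [i], against [eD]. *)
have [eD'|nD'] := eqVneq (D j (x^-1 * g i)) (D j x^-1); last first.
  have comm : g j * x^-1 = x^-1 * g i by rewrite xV in nD' *; apply: (dm_exch mod).
  move: eD; have -> : x * g j = g i * x.
    by rewrite -[LHS]invgK invgM gV comm invgM gV invgK.
  by rewrite (dm_flip mod); case: (D i _).
have [Dj|nDj] := boolP (D j x^-1); case: (boolP (D i x)) => [Di|nDi];
  by rewrite ?eD ?(negPf nDi) ?Di ?invgM ?gV ?eD' ?Dj ?(negPf nDj) ?mulgA.
Qed.

Lemma lstarw_rstar u j w :
  lstarw u (rstar j (evw w)) = rstar j (lstarw u (evw w)).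
Proof.
elim: u => [|i u /= ->] //; have [v ->] := lstarw_word u w.
exact: lstar_rstar.
Qed.

Lemma lstarw_greduced r : greduced r -> lstarw r 1 = evw r.
Proof.
elim: r => [|i r IHr] //= rir; rewrite IHr; last exact: greduced_behead rir.
by rewrite /lstar (negPf (greduced_ascent rir)).
Qed.

(* Left and right star products commute, so that a left star product is
   determined by its value at 1. *)
Lemma lstarw_eq1 u v w :
  lstarw u 1 = lstarw v 1 -> lstarw u (evw w) = lstarw v (evw w).
Proof.
move=> euv; have [r [rr _ <- _]] := reduced_word w; move: rr.
elim/last_ind: r => [|r j IHr] //= rrj.
have rjr := greduced_rev rrj; rewrite rev_rcons in rjr.
have -> : evw (rcons r j) = rstar j (evw r).
  rewrite /rstar -(wordval_rev gen_sqr) (negPf (greduced_ascent rjr)).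
  by rewrite wordval_rcons.
rewrite !lstarw_rstar IHr // -[r]revK.
exact/greduced_rev/greduced_behead/rjr.
Qed.

Lemma lstarw_cat u v x : lstarw (u ++ v) x = lstarw u (lstarw v x).
Proof. exact: foldr_cat. Qed.

(** The operators satisfy the Hecke relations. By [lstarw_eq1] the braid relation is needed only at
    1, where both alternating words are reduced and take the same value. *)
Lemma lstarw_hclass u v w :
  hclass M u = hclass M v -> lstarw u (evw w) = lstarw v (evw w).
Proof.
move=> /pclassE uv; pose f u w := lstarw u (evw w).
suff: f u = f v by move/(congr1 (fun f => f w)).
move: uv; apply: congruence_invariant => a b {}u {}v uv.
apply/funext => {}w; rewrite /f !lstarw_cat.
have [{}w ->] := lstarw_word b w; congr (lstarw a _).
case: uv w => [i|i j neq_ij _] w.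
  rewrite /= {1}/lstar; case: ifP => //; rewrite /lstar.
  by case: ifP => [->//|nDi]; rewrite (dm_flip mod) nDi.
have neq_ji : j != i by rewrite eq_sym.
apply: lstarw_eq1; rewrite !lstarw_greduced.
- exact: (wordval_alternating gen_sqr (dm_rel mod i j)).
- by apply: greduced_alternating => //; rewrite cox_entry_sym.
- exact: greduced_alternating.
Qed.

(** The identification of the Hecke monoid with the image of the Coxeter group in [G]; by
    [lstarw_hclass] any word of the class may replace [repr h]. *)
Definition hval (h : hecke M) : G := lstarw (repr h) 1.

Lemma hval_hclass w : hval (hclass M w) = lstarw w 1.
Proof. exact: (lstarw_hclass [::] (hclassE _)). Qed.

Lemma hecke_reduced h : exists2 r, greduced r & hclass M r = h /\ evw r = hval h.
Proof.
suff [r rr [hr er]] : exists2 r, greduced r &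
    hclass M r = hclass M (repr h) /\ evw r = lstarw (repr h) 1.
  by exists r => //; rewrite hr hclassE.
elim: (repr h) => [|i w [r rr [hr er]]]; first by exists [::].
rewrite -[i :: w]cat1s -hclassM -hr /= /lstar -er.
case: (boolP (D i _)) => [Di|nDi]; last first.
  by exists (i :: r); [apply: greduced_cons | rewrite hclassM].
exists r => //; split => //; have [v [rv ev _]] := descent_word rr Di.
have <- := hclass_braid (matsumoto rv rr ev).
by rewrite -[i :: v]cat1s -hclassM mulgA hgen_idem.
Qed.

Lemma hval_word h : exists w, hval h = evw w.
Proof. by have [r _ [_ <-]] := hecke_reduced h; exists r. Qed.

Lemma hval_greduced r : greduced r -> hval (hclass M r) = evw r.
Proof. by move=> rr; rewrite hval_hclass lstarw_greduced. Qed.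

Lemma hval_inj : injective hval.
Proof.
move=> h h'; have [r rr [<- <-]] := hecke_reduced h.
have [s rs [<- <-]] := hecke_reduced h'.
by move=> ers; apply/hclass_braid/matsumoto.
Qed.

Lemma hval1 : hval 1 = 1.
Proof. by rewrite -hclass1 hval_hclass. Qed.

Lemma hvalM w h : hval (hclass M w * h) = lstarw w (hval h).
Proof. by rewrite -[h]hclassE hclassM !hval_hclass lstarw_cat. Qed.

Lemma hval_genM i h : hval (hgen M i * h) = lstar i (hval h).
Proof. exact: hvalM. Qed.

Lemma hval_rev w : hval (hclass M (rev w)) = (hval (hclass M w))^-1.
Proof.
have [r rr [hr <-]] := hecke_reduced (hclass M w).
rewrite -(hclass_rev hr) hval_greduced ?(wordval_rev gen_sqr) //.
exact: greduced_rev.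
Qed.

Lemma gen_mul_neq i x : g i * x <> x.
Proof.
rewrite -[in RHS](mul1g x) => /mulIg gi1.
have := dm_flip mod i [::]; rewrite /= mulg1 gi1.
by case: (D i 1).
Qed.

(** The test by which zeros are recognised: absorption in the monoid is read as a descent in the
    model. *)
Lemma hgenM_absorb i h : hgen M i * h = h <-> D i (hval h).
Proof.
split=> [eh|Di]; last by apply: hval_inj; rewrite hval_genM /lstar Di.
apply/negPn/negP => nDi; have := hval_genM i h.
by rewrite eh /lstar (negPf nDi) => /esym /gen_mul_neq.
Qed.

Lemma hgenMr_absorb i h : h * hgen M i = h <-> D i (hval h)^-1.
Proof.
have [w <-] : exists w, hclass M w = h by exists (repr h); apply: hclassE.
rewrite -hval_rev -hgenM_absorb !hclassM.
split=> /hclass_rev; first by rewrite rev_cat.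
by rewrite cat1s rev_cons revK cats1.
Qed.

(** * Identification of the Hecke monoid with the Coxeter group *)

Definition cval (x : coxeter M) : G := evw (repr x).

Lemma cclassE (x : coxeter M) : cclass M (repr x) = x.
Proof. exact: pclass_repr. Qed.

Lemma cval_cclass w : cval (cclass M w) = evw w.
Proof. by apply/cclassP/cclassE. Qed.

Lemma cval_inj : injective cval.
Proof. by move=> x y /cclassP; rewrite !cclassE. Qed.

Lemma cvalM : {morph cval : x y / x * y}.
Proof.
by move=> x y; rewrite -[x]cclassE -[y]cclassE cclassM !cval_cclass wordval_cat.
Qed.

Lemma hval_to_hecke x : hval (to_hecke x) = cval x.
Proof.
rewrite /to_hecke; case: xgetP => [w _ /= [<- /reducedP rw]|].
  by rewrite hval_greduced // cval_cclass.
have [r [rr _ _ cr]] := reduced_word (repr x).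
by move=> /(_ r) []; split; [rewrite cr cclassE | apply/reducedP].
Qed.

Lemma to_hecke_inj : injective (@to_hecke I M).
Proof. by move=> x y /(congr1 hval); rewrite !hval_to_hecke => /cval_inj. Qed.

Lemma to_hecke_cclass r : greduced r -> to_hecke (cclass M r) = hclass M r.
Proof.
by move=> rr; apply: hval_inj; rewrite hval_to_hecke cval_cclass hval_greduced.
Qed.

Lemma mem_hecke_support w i : (i \in hecke_support (hclass M w)) = (i \in w).
Proof.
rewrite inE; apply/asboolP/idP => [[v [_ /hclass_mem-> //]]|iw].
have [r rr [hr _]] := hecke_reduced (hclass M w); exists r; split => //.
  exact/reducedP.
by rewrite (hclass_mem hr).
Qed.

Lemma hsub_support h : hsub (hecke_support h) h.
Proof.
exists (repr h); last exact: hclassE.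
by move=> k kh; rewrite -[h]hclassE mem_hecke_support.
Qed.

(** * Parabolic subgroups, longest elements and idempotents *)

Lemma parabolic_subgroupP J x :
  parabolic_subgroup J x <-> exists2 w, {subset w <= J} & x = cclass M w.
Proof.
pose P (x : coxeter M) := exists2 w : seq I, {subset w <= J} & x = cclass M w.
have PM : is_subgroup P.
  split=> [|_ _ [u su ->] [v sv ->]]; first by exists [::].
  exists (u ++ rev v); last by rewrite !cclass_wordval wordval_cat (wordval_rev cgen_sqr).
  by move=> k; rewrite mem_cat mem_rev => /orP[/su|/sv].
split=> [|[w sw ->] S [[S1 SM] sJS]].
  move=> Jx; apply: (Jx P); split=> // _ [i /= iJ <-]; exists [:: i] => //.
  by move=> k; rewrite inE => /eqP->.
have SV y : S y -> S y^-1 by rewrite -[y^-1]mul1g => Sy; apply: SM.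
elim: w sw => [|i w IHw] sw; first exact: S1.
rewrite -[i :: w]cat1s -cclassM -[cclass M w]invgK; apply: SM.
  by apply: sJS; exists i => //; apply: sw; rewrite mem_head.
by apply/SV/IHw => k kw; apply: sw; rewrite inE kw orbT.
Qed.

Lemma clength_cclass r : greduced r -> clength (cclass M r) = size r.
Proof. by move/reducedP. Qed.

Lemma spherical_model J : spherical M J.
Proof.
apply: (@sub_finite_set _ _ (preimage cval classical_sets.setT)) => //.
by apply: finite_preimage; [move=> x y _ _; apply: cval_inj|exact: finite_finset].
Qed.

Lemma ex_longest J : exists x : coxeter M, is_longest J x.
Proof.
(* [cval] embeds the Coxeter group in the finite [G], so transporting the length along it bounds all
   lengths; off the image the default 1 is harmless. *)
pose F (a : G) := clength (xget (1 : coxeter M) (fun x => cval x = a)).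
have leF (x : coxeter M) : clength x <= \max_a F a.
  have -> : clength x = F (cval x).
    rewrite /F; case: xgetP => [y _ /= /cval_inj-> //|/(_ x) []//].
  exact: leq_bigmax.
pose P l := `[< exists2 x : coxeter M, parabolic_subgroup J x & clength x = l >].
have exP : exists l, P l.
  exists (clength (1 : coxeter M)); apply/asboolP; exists 1 => //.
  by apply/parabolic_subgroupP; exists [::].
have ubP l : P l -> l <= \max_a F a by move=> /asboolP[x _ <-].
case: (ex_maxnP exP ubP) => l /asboolP[x Jx <-] lmax.
by exists x; split => // y Jy; apply: lmax; apply/asboolP; exists y.
Qed.

(** A letter of [J] that is not a descent could be prepended to give a longer element of [W_J]. *)
Lemma hzero_w0 J : hzero J (to_hecke (w0 M J)).
Proof.
have [Jx xmax] : is_longest J (w0 M J).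
  by rewrite /w0; case: xgetP => // nl; have [x /nl] := ex_longest J.
have /parabolic_subgroupP[w sw def_w0] := Jx.
have [r [rr sr _ cr]] := reduced_word w.
rewrite def_w0 -cr in Jx xmax *.
rewrite to_hecke_cclass //; apply: hzero_left.
  by exists r => // k /sr/sw.
move=> i iJ; apply/hgenM_absorb; rewrite hval_greduced //.
apply/negPn/negP => /(greduced_cons rr) rir.
have := xmax (cclass M (i :: r)).
rewrite !clength_cclass //= ltnn => /(_ _)/notF; apply.
apply/parabolic_subgroupP; exists (i :: r) => // k.
by rewrite inE => /orP[/eqP->|/sr/sw].
Qed.

(** Multiplying by the letters of a reduced word of [h] one after another never shortens, and
    lengthens at each letter that is not a descent. As the result is [h] again, every letter of the
    support is a descent. *)
Lemma idempotent_hzero h : h * h = h -> hzero (hecke_support h) h.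
Proof.
have [r rr [<- er]] := hecke_reduced h => hh.
apply: hzero_left; first exact: hsub_support.
have grow u : exists2 s, greduced s & evw s = lstarw u (evw r) /\
    (size s <= size r -> evw s = evw r /\ {in u, forall i, D i (evw r)})
    /\ size r <= size s.
  elim: u => [|i u [s rs [es [sr rs']]]]; first by exists r.
  rewrite /= -es /lstar; case: (boolP (D i _)) => [Di|nDi].
    exists s => //; split => //; split => // /sr[esr Du]; split => // k.
    by rewrite inE => /orP[/eqP->|/Du//]; rewrite -esr.
  exists (i :: s); first exact: greduced_cons.
  by split => //=; split; lia.
have [s rs [es [sr _]]] := grow r.
have esr : evw s = evw r.
  by rewrite es -(lstarw_greduced rr) -hval_hclass -hvalM hh.
move=> i; rewrite mem_hecke_support => ir; apply/hgenM_absorb.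
rewrite hval_greduced //; have [|_] := sr; last exact.
by rewrite (greduced_size rs rr esr).
Qed.

Lemma w0_eq J x : hzero J (to_hecke x) -> w0 M J = x.
Proof. by move=> xJ; apply/to_hecke_inj/(hzero_uniq (hzero_w0 J) xJ). Qed.

Lemma w0_set0 : w0 M finset.set0 = 1.
Proof.
apply: w0_eq; rewrite -[1]/(cclass M [::]) to_hecke_cclass //.
by split; [apply: hsub1 | move=> i; rewrite inE].
Qed.

Lemma greduced1 i : greduced [:: i].
Proof. by apply: greduced_cons => //; apply: (dm_one mod). Qed.

Lemma w0_set1 i : w0 M (finset.set1 i) = cgen M i.
Proof.
apply: w0_eq; rewrite to_hecke_cclass; last exact: greduced1.
split; first by apply: hsub_gen; rewrite !inE.
by move=> j; rewrite inE => /eqP->; rewrite hgen_idem.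
Qed.

Lemma w0_sqr J : w0 M J * w0 M J = 1.
Proof.
suff {1}-> : w0 M J = (w0 M J)^-1 by rewrite mulVg.
have [r rr [hr _]] := hecke_reduced (to_hecke (w0 M J)).
have def_w0 : w0 M J = cclass M r by apply: to_hecke_inj; rewrite to_hecke_cclass.
have rJ : hzero J (hclass M r) by rewrite hr; apply: hzero_w0.
apply: w0_eq; rewrite def_w0 cclass_wordval -(wordval_rev cgen_sqr) -cclass_wordval.
by rewrite to_hecke_cclass ?(hzero_rev rJ) //; apply: greduced_rev.
Qed.

(** Since [h] does not absorb [i], the star product by [i] is the group product, and the generator
    is an involution. This computes [wpair] for singletons. *)
Lemma to_hecke_cgenM i x h :
  hgen M i * h = to_hecke x -> h <> to_hecke x -> to_hecke (cgen M i * x) = h.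
Proof.
move=> ihx neq_hx; apply: hval_inj.
rewrite hval_to_hecke cvalM -(hval_to_hecke x) -ihx hval_genM /lstar.
case: ifP => [/hgenM_absorb e|_]; first by case: neq_hx; rewrite -ihx e.
by rewrite cval_cclass /= mulg1 gen_mulK.
Qed.

End DescentModel.

(** * Type B2 *)

(* [(a, b, s)] is the signed permutation matrix diag(+-1, +-1) * swap^s, where
   [a] and [b] tell which signs are negative. *)
Definition signed2 := (bool * bool * bool)%type.

HB.instance Definition _ := Finite.on signed2.

Definition signed2_mul (x y : signed2) : signed2 :=
  let: (a, b, s) := x in let: (a', b', s') := y in
  (a (+) (if s then b' else a'), b (+) (if s then a' else b'), s (+) s').

Definition signed2_one : signed2 := (false, false, false).

Definition signed2_inv (x : signed2) : signed2 :=
  let: (a, b, s) := x in if s then (b, a, s) else x.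

Lemma signed2_mulA : associative signed2_mul.
Proof. by move=> [[[] []] []] [[[] []] []] [[[] []] []]. Qed.

Lemma signed2_mul1 : left_id signed2_one signed2_mul.
Proof. by move=> [[[] []] []]. Qed.

Lemma signed2_mulV : left_inverse signed2_one signed2_inv signed2_mul.
Proof. by move=> [[[] []] []]. Qed.

HB.instance Definition _ :=
  Finite_isGroup.Build signed2 signed2_mulA signed2_mul1 signed2_mulV.

Definition B2_gen (i : 'I_2) : signed2 :=
  if i == ord0 then (true, false, false) else (false, false, true).

(** The simple roots are e1 for [ord0] and e2 - e1 for the other index; the value says whether the
    inverse of [x] makes the root negative. *)
Definition B2_descent (i : 'I_2) (x : signed2) : bool :=
  let: (a, b, s) := x in if i == ord0 then a else if s then ~~ a else b.

Lemma B2_model : descent_model B2 B2_gen B2_descent.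
Proof.
have gen0 : B2_gen (Ordinal (isT : 0 < 2)) = (true, false, false) by [].
have gen1 : B2_gen (Ordinal (isT : 1 < 2)) = (false, false, true) by [].
(* Closed ordinals make the finite checks below computable. *)
have I2 (P : 'I_2 -> Prop) : P (Ordinal (isT : 0 < 2)) ->
    P (Ordinal (isT : 1 < 2)) -> forall i, P i.
  by move=> P0 P1 [[|[|]] //= lti2]; rewrite (bool_irrelevance lti2 isT).
split.
- by move=> i j; rewrite /= /B2_entry; case: ifP.
- by elim/I2; elim/I2; rewrite /= /B2_entry /= ?expg1 // !expgS.
- by elim/I2.
- by elim/I2=> w; case: (wordval _ w) => [[[] []] []].
- by elim/I2; elim/I2=> w; case: (wordval _ w) => [[[] []] []].
- by elim/I2; elim/I2=> //; case=> [|[|[|[|]]]].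
Qed.

(** * Type D as signed permutations *)

Section SignedSwap.
Variable n : nat.
Hypothesis gt2n : 2 < n.

(* Position [k <= n] stands for the basis vector e_(k+1) and [2n+1-k] for its
   opposite; the simple root i is e_(p+1) - e_(q+1) for [p = root_fst i] and
   [q = i.+1]. *)
Definition root_fst (i : nat) : nat := if i < n then i else n.-1.

(** The reflection in root [i]: [n.*2 - i] is the position opposite to [i.+1]. *)
Definition dswap (i k : nat) : nat :=
  if k == root_fst i then i.+1
  else if k == i.+1 then root_fst i
  else if k == n.*2.+1 - root_fst i then n.*2 - i
  else if k == n.*2 - i then n.*2.+1 - root_fst i
  else k.

Lemma root_fstE i : i <= n -> 
  i < n /\ root_fst i = i \/ i = n /\ root_fst i = n.-1.
Proof. by rewrite /root_fst; case: ltnP; lia. Qed.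

Lemma root_fst_le i : i <= n -> root_fst i < i.+1 /\ root_fst i < n.
Proof. by move/root_fstE; lia. Qed.

Lemma dswapP i k : i <= n ->
  let p := root_fst i in
  k = p /\ dswap i k = i.+1 \/ k = i.+1 /\ dswap i k = p \/
  k = n.*2.+1 - p /\ dswap i k = n.*2 - i \/
  k = n.*2 - i /\ dswap i k = n.*2.+1 - p \/
  dswap i k = k /\
  (k <> p /\ k <> i.+1 /\ k <> n.*2.+1 - p /\ k <> n.*2 - i).
Proof.
move=> lein /=; rewrite /dswap.
by do 4!(case: (k =P _) => [?|?]; first by intuition); intuition.
Qed.

Ltac dswap_cases i k :=
  let H := fresh in
  match goal with lein : is_true (i <= n) |- _ =>
    have /= H := dswapP k lein; decompose [or and] H; clear H
  end.

Lemma dswap_lt i k : i <= n -> k < n.*2.+2 -> dswap i k < n.*2.+2.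
Proof.
by move=> lein ltk; have := root_fst_le lein; dswap_cases i k; lia.
Qed.

Lemma dswap_fst i : dswap i (root_fst i) = i.+1.
Proof. by rewrite /dswap eqxx. Qed.

Lemma dswap_snd i : i <= n -> dswap i i.+1 = root_fst i.
Proof.
by move=> /root_fst_le[+ _]; rewrite /dswap eqxx; case: eqP => // <-; lia.
Qed.

Lemma dswap_fix i k : i <= n ->
  k != root_fst i -> k != i.+1 ->
  k != n.*2.+1 - root_fst i -> k != n.*2 - i -> dswap i k = k.
Proof. by rewrite /dswap => _ /negPf-> /negPf-> /negPf-> /negPf->. Qed.

Lemma dswap_rev i k : i <= n -> k < n.*2.+2 ->
  dswap i (n.*2.+1 - k) = n.*2.+1 - dswap i k.
Proof.
move=> lein ltk; have := root_fst_le lein.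
by dswap_cases i k; dswap_cases i (n.*2.+1 - k); lia.
Qed.

(** The reflections commute with passing to the opposite position, so of the four moved positions
    only two need a check. *)
Lemma dswap_ind i (P : nat -> Prop) : i <= n ->
  P (root_fst i) -> P i.+1 ->
  (forall k, k < n.*2.+2 -> P (n.*2.+1 - k) -> P k) ->
  (forall k, k < n.*2.+2 -> k != root_fst i -> k != i.+1 ->
     k != n.*2.+1 - root_fst i -> k != n.*2 - i -> P k) ->
  forall k, k < n.*2.+2 -> P k.
Proof.
move=> lein P1 P2 Pr Pf k ltk; have [ltp _] := root_fst_le lein.
case: (eqVneq k (root_fst i)) => [->//|n1].
case: (eqVneq k i.+1) => [->//|n2].
case: (eqVneq k (n.*2.+1 - root_fst i)) => [def_k|n3].
  by apply: Pr; rewrite // def_k subKn //; lia.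
case: (eqVneq k (n.*2 - i)) => [def_k|n4]; last exact: Pf.
by apply: Pr; rewrite // def_k (_ : _ - _ = i.+1) //; lia.
Qed.

Lemma dswapK i k : i <= n -> k < n.*2.+2 -> dswap i (dswap i k) = k.
Proof.
move=> lein ltk; have ltd := dswap_lt lein.
apply: (@dswap_ind i (fun k => dswap i (dswap i k) = k)) ltk => //.
- by rewrite dswap_fst dswap_snd.
- by rewrite dswap_snd // dswap_fst.
- move=> l ltl; rewrite !dswap_rev ?ltd //.
  by have := ltd _ (ltd _ ltl); lia.
- by move=> l _ *; rewrite !dswap_fix.
Qed.

(** A simple reflection makes only its own positive root negative; the two alternatives are two
    spellings of this root. Opposite positions are excluded because such a pair is not a root of
    type D. *)
Lemma dswap_flip i a b : i <= n -> a < n.*2.+2 -> b < n.*2.+2 ->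
  a + b != n.*2.+1 -> a < b -> dswap i b < dswap i a ->
  a = root_fst i /\ b = i.+1 \/ a = n.*2 - i /\ b = n.*2.+1 - root_fst i.
Proof.
move=> lein lta ltb ab; have rE := root_fstE lein.
have := dswapP a lein; have /= := dswapP b lein.
move: (root_fst i) (dswap i a) (dswap i b) rE => p a' b'.
case=> [[? ->]|[-> ->]] Hb Ha; decompose [or and] Ha; clear Ha; try lia;
  decompose [or and] Hb; clear Hb; lia.
Qed.

(** Edges of the Coxeter graph in zero-based indices. With this orientation the second position of
    root [i] is the first position of root [j], including at the branch ([dadjE]). *)
Definition dadj i j : bool := (j == i.+1) && (i < n.-1) || (i == n.-2) && (j == n).

Lemma dadjE i j : j <= n -> dadj i j ->
  [/\ i < n.-1, root_fst i = i, root_fst j = i.+1 & i.+1 < j.+1 <= n.+1].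
Proof.
move=> lejn; rewrite /dadj /root_fst => adj.
by case: (ltnP i n) => ?; case: (ltnP j n) => ?; split; lia.
Qed.

Lemma dswap_chain i j : j <= n -> dadj i j ->
  [/\ dswap i i = i.+1, dswap i i.+1 = i & dswap i j.+1 = j.+1] /\
  [/\ dswap j i = i, dswap j i.+1 = j.+1 & dswap j j.+1 = i.+1].
Proof.
move=> lejn adj; have [lti rfi rfj ltj] := dadjE lejn adj.
have lein : i <= n by lia.
split; split.
- by rewrite -{2}rfi dswap_fst.
- by rewrite dswap_snd.
- by rewrite dswap_fix ?rfi //; lia.
- by rewrite dswap_fix ?rfj //; lia.
- by rewrite -rfj dswap_fst.
- by rewrite dswap_snd.
Qed.

(** On the three positions of [dswap_chain] the reflections act as two adjacent transpositions; the
    opposite positions follow by symmetry. *)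
Lemma dswap_braid i j k : j <= n -> dadj i j -> k < n.*2.+2 ->
  dswap i (dswap j (dswap i k)) = dswap j (dswap i (dswap j k)).
Proof.
move=> lejn adj; have [lti rfi rfj ltj] := dadjE lejn adj.
have lein : i <= n by lia.
have ltdi := dswap_lt lein; have ltdj := dswap_lt lejn.
have [[iP iQ iR] [jP jQ jR]] := dswap_chain lejn adj.
move: k; apply: (dswap_ind lein); rewrite ?rfi.
- by rewrite iP jQ iR jP iP jQ.
- by rewrite iQ jP iP jQ iR jR.
- move=> k ltk; have [ik jk] := (ltdi k ltk, ltdj k ltk).
  have [jik ijk] := (ltdj _ ik, ltdi _ jk).
  have [ijik jijk] := (ltdi _ jik, ltdj _ ijk).
  rewrite (dswap_rev lein ltk) (dswap_rev lejn ik) (dswap_rev lein jik).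
  rewrite (dswap_rev lejn ltk) (dswap_rev lein jk) (dswap_rev lejn ijk).
  by lia.
move=> k _ n1 n2 n3 n4; have iF : dswap i k = k by rewrite dswap_fix ?rfi.
case: (eqVneq k j.+1) => [->|n5]; first by rewrite iR jR iQ jP.
have [def_k|n6] := eqVneq k (n.*2 - j).
  have ltk : k < n.*2.+2 by lia.
  rewrite (_ : k = n.*2.+1 - j.+1); last by lia.
  have ltj' : j.+1 < n.*2.+2 by lia.
  have lti1 : i.+1 < n.*2.+2 by lia.
  have lti' : i < n.*2.+2 by lia.
  by rewrite !(dswap_rev, iR, jR, iQ, jP).
have jF : dswap j k = k by rewrite dswap_fix ?rfj // (_ : _ - _ = n.*2 - i); lia.
by rewrite iF jF iF jF.
Qed.

Lemma dswap_comm i j k : i <= n -> j <= n -> i != j -> ~~ dadj i j ->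
  ~~ dadj j i -> k < n.*2.+2 -> dswap i (dswap j k) = dswap j (dswap i k).
Proof.
wlog: i j / i < j => [gen|ltij] lein lejn neq_ij nij nji ltk.
  have [ltij|leji] := ltnP i j; first exact: gen.
  by symmetry; apply: gen; rewrite // 1?eq_sym //; lia.
have rEi := root_fstE lein; have rEj := root_fstE lejn.
have ltdi := dswap_lt lein; have ltdj := dswap_lt lejn.
have rfi : root_fst i = i by lia.
have iP : dswap i i = i.+1 by rewrite -{2}rfi dswap_fst.
have iQ : dswap i i.+1 = i by rewrite dswap_snd.
have {rEi rEj} Hj : j < n /\ root_fst j = j /\ i.+1 < j \/
    j = n /\ root_fst j = n.-1 /\ (i = n.-1 \/ i < n.-2).
  by move: nij rEj; rewrite /dadj; lia.
(* Either the moved positions are disjoint, or the roots are the two ends of the fork, which move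
   the same four positions. *)
have [sep|[def_i [def_j rfj]]] :
    i.+1 < root_fst j \/ i = n.-1 /\ (j = n /\ root_fst j = n.-1) by lia.
  have [ltp _] := root_fst_le lejn.
  have jF l : l <= i.+1 -> dswap j l = l by move=> ?; rewrite dswap_fix //; lia.
  have iF l : root_fst j <= l -> l <= n.+1 -> dswap i l = l.
    by move=> ? ?; rewrite dswap_fix ?rfi //; lia.
  move: k ltk; apply: (dswap_ind lein); rewrite ?rfi.
  - by rewrite (jF i) // iP jF.
  - by rewrite (jF i.+1) // iQ jF.
  - move=> l ltl; have [il jl] := (ltdi l ltl, ltdj l ltl).
    have [jil ijl] := (ltdj _ il, ltdi _ jl).
    rewrite (dswap_rev lejn ltl) (dswap_rev lein jl).
    by rewrite (dswap_rev lein ltl) (dswap_rev lejn il); lia.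
  move=> l ltl n1 n2 n3 n4.
  have il : dswap i l = l by rewrite dswap_fix ?rfi.
  rewrite il; move: l ltl {n1 n2 n3 n4} il; apply: (dswap_ind lejn).
  - by move=> _; rewrite dswap_fst iF //; lia.
  - by move=> _; rewrite dswap_snd // iF //; lia.
  - move=> l ltl IHl il; have jl := ltdj l ltl; have ijl := ltdi _ jl.
    move: IHl; rewrite (dswap_rev lein ltl) il (dswap_rev lejn ltl).
    by rewrite (dswap_rev lein jl) => /(_ erefl); lia.
  - by move=> l _ *; rewrite [dswap j l]dswap_fix.
have in1 : i.+1 = n by lia.
have jP : dswap j i = n.*2.+1 - i.+1 by rewrite def_i -rfj dswap_fst; lia.
have jR : dswap j j.+1 = i by rewrite dswap_snd // def_i.
have jQ : dswap j i.+1 = n.*2.+1 - i.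
  by rewrite (_ : i.+1 = n.*2.+1 - j.+1) ?dswap_rev ?jR //; lia.
have [lti lti1] : i < n.*2.+2 /\ i.+1 < n.*2.+2 by lia.
move: k ltk; apply: (dswap_ind lein); rewrite ?rfi.
- by rewrite jP (dswap_rev lein lti1) iP iQ jQ.
- by rewrite jQ (dswap_rev lein lti) iP iQ jP.
- move=> l ltl; have [il jl] := (ltdi l ltl, ltdj l ltl).
  have [jil ijl] := (ltdj _ il, ltdi _ jl).
  rewrite (dswap_rev lejn ltl) (dswap_rev lein jl).
  by rewrite (dswap_rev lein ltl) (dswap_rev lejn il); lia.
move=> l _ n1 n2 n3 n4; have il : dswap i l = l by rewrite dswap_fix ?rfi.
have jl : dswap j l = l by rewrite dswap_fix ?rfj //; lia.
by rewrite il jl.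
Qed.

End SignedSwap.

(** * The descent model of type D *)

Section DModel.
Variable n : nat.
Hypothesis gt2n : 2 < n.

Local Notation pos := 'I_(n.*2.+2).
Implicit Types (i j : 'I_n.+1) (w : seq 'I_n.+1).

Definition dswap_ord i (k : pos) : pos :=
  Ordinal (dswap_lt gt2n (leq_ord i) (ltn_ord k)).

Lemma dswap_ordK i : involutive (dswap_ord i).
Proof. by move=> k; apply: val_inj; apply: (dswapK gt2n (leq_ord i)). Qed.

Definition D_gen i : {perm pos} := perm (inv_inj (dswap_ordK i)).

Lemma D_genE i k : D_gen i k = dswap n i k :> nat.
Proof. by rewrite permE. Qed.

(* Permutations compose from left to right, so that [x] is the inverse of the
   group element acting on vectors. *)
Definition D_descent i (x : {perm pos}) : bool :=
  x (inord i.+1) < x (inord (root_fst n i)).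

Local Notation evw := (wordval D_gen).

Lemma D_gen_sqr i : D_gen i * D_gen i = 1.
Proof. by apply/permP=> k; rewrite permM perm1 !permE dswap_ordK. Qed.

Lemma D_gen_rev i k : D_gen i (rev_ord k) = rev_ord (D_gen i k).
Proof.
apply: val_inj; rewrite /= !permE /= subSS.
by rewrite (dswap_rev gt2n (leq_ord i) (ltn_ord k)) !subSS.
Qed.

Lemma wordval_rev_ord w k : evw w (rev_ord k) = rev_ord (evw w k).
Proof.
by elim: w k => [|i w IHw] k; rewrite ?perm1 //= !permM D_gen_rev IHw.
Qed.

Lemma D_entryE i j : D n i j =
  if i == j then 1%N else if dadj n i j || dadj n j i then 3 else 2.
Proof.
rewrite /= /D_entry; case: eqP => // _; congr (if _ then _ else _).
by rewrite /D_edge /dadj; have := ltn_ord i; have := ltn_ord j; lia.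
Qed.

Lemma root_positions i : let p : pos := inord (root_fst n i) in
  let q : pos := inord i.+1 in
  [/\ p = root_fst n i :> nat, q = i.+1 :> nat & p < q].
Proof.
have [ltp ltpn] := root_fst_le gt2n (leq_ord i); have lti := leq_ord i.
by rewrite /= !inordK //; lia.
Qed.

Lemma D_gen_root i : D_gen i (inord (root_fst n i)) = inord i.+1 /\
  D_gen i (inord i.+1) = inord (root_fst n i).
Proof.
have [/= ep eq _] := root_positions i.
by split; apply: val_inj; rewrite /= D_genE ?ep ?eq ?dswap_fst ?dswap_snd // leq_ord.
Qed.

Lemma D_gen_flip i (a b : pos) : b != rev_ord a -> a < b ->
  D_gen i b < D_gen i a ->
  a = inord (root_fst n i) /\ b = inord i.+1 \/
  a = rev_ord (inord i.+1) /\ b = rev_ord (inord (root_fst n i)).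
Proof.
move=> nab ltab; rewrite !D_genE; have [/= ep eq _] := root_positions i.
case/(dswap_flip gt2n (leq_ord i) (ltn_ord a) (ltn_ord b)); first 1 last.
- by [].
- by move=> [ea eb]; left; split; apply: val_inj; rewrite /= ?ep ?eq.
- by move=> [ea eb]; right; split; apply: val_inj; rewrite /= ?ep ?eq ?subSS.
apply: contraNneq nab => e; apply/eqP/val_inj => /=; rewrite subSS.
by have := ltn_ord a; lia.
Qed.

(** The reflection [j] changes the sign of its own root only, so [x] carries root [i] to root [j] up
    to sign, and therefore conjugates one reflection to the other. *)
Lemma D_exchange i j w :
  D_descent i (evw w * D_gen j) != D_descent i (evw w) ->
  D_gen i * evw w = evw w * D_gen j.
Proof.
set x := evw w; rewrite /D_descent !permM.
have [/= ep eq ltpq] := root_positions i.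
have [Dp Dq] := D_gen_root i; have [Dp' Dq'] := D_gen_root j.
set p := inord (root_fst n i) in ep ltpq Dp Dq *.
set q := inord i.+1 in eq ltpq Dp Dq *.
set p' := inord (root_fst n j) in Dp' Dq' *; set q' := inord j.+1 in Dp' Dq' *.
have neq_pq : p != q by rewrite -(inj_eq val_inj) /= ; lia.
have neq_rev : x q != rev_ord (x p).
  rewrite -wordval_rev_ord (inj_eq perm_inj) -(inj_eq val_inj) /= ep eq.
  have := root_fstE gt2n (leq_ord i); have := ltn_ord i; lia.
have neq_x : x p != x q by rewrite (inj_eq perm_inj).
move=> flip.
have Hx : x p = p' /\ x q = q' \/ x p = q' /\ x q = p' \/
    x p = rev_ord p' /\ x q = rev_ord q' \/
    x p = rev_ord q' /\ x q = rev_ord p'.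
  have neq_g : D_gen j (x p) != D_gen j (x q) by rewrite (inj_eq perm_inj).
  have := neq_x; rewrite -(inj_eq val_inj) /= neq_ltn => /orP[lt|lt].
    have ltg : D_gen j (x q) < D_gen j (x p).
      by move: flip; rewrite [x q < x p]ltnNge (ltnW lt) /=; case: ltnP.
    by have := D_gen_flip neq_rev lt ltg; intuition.
  have ltg : D_gen j (x p) < D_gen j (x q).
    rewrite ltn_neqAle (inj_eq val_inj) neq_g /=.
    by move: flip; rewrite lt; case: ltnP.
  have neq_rev' : x p != rev_ord (x q).
    by apply: contraNneq neq_rev => ->; rewrite rev_ordK.
  by have := D_gen_flip neq_rev' lt ltg; intuition.
have at_pq : x (D_gen i p) = D_gen j (x p) /\ x (D_gen i q) = D_gen j (x q).
  rewrite Dp Dq; by case: Hx => [[-> ->]|[[-> ->]|[[-> ->]|[-> ->]]]];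
    rewrite ?D_gen_rev ?Dp' ?Dq'.
apply/permP=> k; rewrite !permM.
have [->|np] := eqVneq k p; first by case: at_pq.
have [->|nq] := eqVneq k q; first by case: at_pq.
have [->|nrp] := eqVneq k (rev_ord p).
  by rewrite D_gen_rev !wordval_rev_ord D_gen_rev; case: at_pq => ->.
have [->|nrq] := eqVneq k (rev_ord q).
  by rewrite D_gen_rev !wordval_rev_ord D_gen_rev; case: at_pq => _ ->.
have genF (l : 'I_n.+1) (y : pos) : y != inord (root_fst n l) -> y != inord l.+1 ->
    y != rev_ord (inord (root_fst n l)) -> y != rev_ord (inord l.+1) ->
    D_gen l y = y.
  have [/= ep1 eq1 _] := root_positions l.
  rewrite -!(inj_eq val_inj) /= ep1 eq1 !subSS => n1 n2 n3 n4.
  by apply: val_inj; rewrite /= D_genE dswap_fix // leq_ord.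
have [n1 n2 n3 n4] : [/\ x k != x p, x k != x q, x k != rev_ord (x p)
    & x k != rev_ord (x q)].
  by rewrite -!wordval_rev_ord !(inj_eq perm_inj).
rewrite (genF i k) //; symmetry; move: n1 n2 n3 n4.
by case: Hx => [[-> ->]|[[-> ->]|[[-> ->]|[-> ->]]]];
  rewrite ?rev_ordK => *; apply: genF.
Qed.

Lemma D_model : descent_model (D n) D_gen D_descent.
Proof.
have adj_exp i j : i != j -> dadj n i j -> (D_gen i * D_gen j) ^+ 3 = 1.
  move=> neq_ij adj.
  have braid : D_gen i * D_gen j * D_gen i = D_gen j * D_gen i * D_gen j.
    apply/permP=> k; apply: val_inj; rewrite /= !permM !D_genE.
    exact: (dswap_braid gt2n (leq_ord j) adj (ltn_ord k)).
  rewrite !expgS expg0 mulg1 !mulgA braid -!mulgA.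
  by rewrite !(mulgA (D_gen j) (D_gen j)) !D_gen_sqr mul1g
             (mulgA (D_gen i) (D_gen i)) D_gen_sqr mul1g D_gen_sqr.
split.
- by move=> i j; rewrite D_entryE; case: ifP => // _; case: ifP.
- move=> i j; rewrite D_entryE; case: eqVneq => [->|neq_ij].
    by rewrite expg1 D_gen_sqr.
  case: ifP => [/orP[adj|adj]|/norP[nij nji]].
  + exact: adj_exp.
  + have neq_ji : j != i by rewrite eq_sym.
    have V l : (D_gen l)^-1 = D_gen l by rewrite (mulg1_eq (D_gen_sqr l)).
    apply: invg_inj; rewrite -expgVn invgM !V invg1; exact: adj_exp.
  have comm : D_gen i * D_gen j = D_gen j * D_gen i.
    apply/permP=> k; apply: val_inj; rewrite /= !permM !D_genE.
    by rewrite (dswap_comm gt2n (leq_ord j) (leq_ord i)) // eq_sym.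
  by rewrite expgS expg1 {1}comm mulgA -(mulgA _ _ (D_gen i)) D_gen_sqr mulg1 D_gen_sqr.
- move=> i; rewrite /D_descent !perm1; have [_ _ /=] := root_positions i.
  by rewrite -leqNgt => /ltnW.
- move=> i w; rewrite /D_descent !permM; have [-> ->] := D_gen_root i.
  rewrite -leqNgt ltn_neqAle; have [/= ep eq ltpq] := root_positions i.
  rewrite (inj_eq val_inj) (inj_eq perm_inj) -(inj_eq val_inj) /=.
  by rewrite neq_ltn ltpq.
- exact: D_exchange.
move=> i j m neq_ij; rewrite D_entryE (negPf neq_ij) => ltm.
have [/= ep eq ltpq] := root_positions i.
have nrev : inord i.+1 != rev_ord (inord (root_fst n i) : pos).
  rewrite -(inj_eq val_inj) /= ep eq.
  have := root_fstE gt2n (leq_ord i); have := ltn_ord i; lia.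
rewrite /D_descent -leqNgt leqNgt; apply/negP.
(* Off the diagonal the entries are at most 3, so [m] is 0, 1 or 2, and only an edge allows 2. *)
case: m ltm => [_|[_|[|m]]]; first by rewrite !perm1 ltnNge ltnW.
- rewrite /= mulg1 => /(D_gen_flip nrev ltpq)[[_ /(congr1 val)]|[/(congr1 val)]].
    have [/= _ -> _] := root_positions j; rewrite eq => [[e]].
    by case/eqP: neq_ij; apply: val_inj.
  have [/= _ e _] := root_positions j; rewrite ep e.
  by have := root_fst_le gt2n (leq_ord i); have := ltn_ord j; lia.
- case: ifP => // /orP[] adj _; rewrite /= mulg1 !permM !D_genE ep eq.
    have [ltin -> rfj ltj] := dadjE gt2n (leq_ord j) adj.
    have [[iP _ iR] [jP jQ _]] := dswap_chain gt2n (leq_ord j) adj.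
    by rewrite jQ iR jP iP; lia.
  have [ltjn rfj -> lti] := dadjE gt2n (leq_ord i) adj.
  have [[_ jQ jR] [iP _ iR]] := dswap_chain gt2n (leq_ord i) adj.
  by rewrite jR iR jQ iP; lia.
- by case: ifP.
Qed.

End DModel.

(** * Negative coordinates of star products *)

Section DComputations.
Variable n : nat.
Hypothesis gt2n : 2 < n.

Local Notation pos := 'I_(n.*2.+2).
Local Notation D_gen := (D_gen gt2n).
Local Notation D_desc := (@D_descent n).
Local Notation evw := (wordval D_gen).
Local Notation hv := (hval D_gen D_desc).
Local Notation mod := (D_model gt2n).
Implicit Types (i j : 'I_n.+1) (w : seq 'I_n.+1) (x y : {perm pos}).
Implicit Types (J : {set 'I_n.+1}) (h : hecke (D n)).

Definition at_pos x (z : nat) : nat := x (inord z).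

Lemma at_pos_inj x z z' : z < n.*2.+2 -> z' < n.*2.+2 ->
  at_pos x z = at_pos x z' -> z = z'.
Proof.
by move=> ltz ltz' /val_inj/perm_inj/(congr1 val); rewrite /= !inordK.
Qed.

Lemma at_pos_surj x v : v < n.*2.+2 -> exists2 z, z < n.*2.+2 & at_pos x z = v.
Proof.
move=> ltv; exists (x^-1 (inord v) : pos) => //.
by rewrite /at_pos inord_val permKV inordK.
Qed.

Lemma at_pos_le x z : at_pos x z <= n.*2.+1.
Proof. exact: leq_ord. Qed.

Lemma at_pos_rev w z : z <= n.*2.+1 ->
  at_pos (evw w) (n.*2.+1 - z) = n.*2.+1 - at_pos (evw w) z.
Proof.
move=> lez; rewrite /at_pos (_ : inord (_ - z) = rev_ord (inord z)).
  by rewrite wordval_rev_ord /= subSS.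
by apply: val_inj; rewrite /= !inordK ?subSS //; lia.
Qed.

Lemma at_pos_mid w : at_pos (evw w) n.+1 = n.*2.+1 - at_pos (evw w) n.
Proof. by rewrite -at_pos_rev; [congr at_pos|]; lia. Qed.

Lemma at_pos_gen i x z : z <= n.*2.+1 ->
  at_pos (D_gen i * x) z = at_pos x (dswap n i z).
Proof.
move=> lez; rewrite /at_pos permM; congr (nat_of_ord (x _)).
by apply: val_inj; rewrite /= D_genE !inordK // dswap_lt // leq_ord.
Qed.

Lemma at_pos1 z : z <= n.*2.+1 -> at_pos 1 z = z.
Proof. by move=> lez; rewrite /at_pos perm1 inordK. Qed.

Lemma D_descentE i x : D_desc i x = (at_pos x i.+1 < at_pos x (root_fst n i)).
Proof. by []. Qed.

Lemma root_fst_lt (i : nat) : i < n -> root_fst n i = i.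
Proof. by rewrite /root_fst => ->. Qed.

Lemma root_fst_last : root_fst n n = n.-1.
Proof. by rewrite /root_fst ltnn. Qed.

Lemma ord_at z : z <= n -> exists i, i = z :> nat.
Proof. by move=> lez; exists (inord z); rewrite inordK. Qed.

Lemma decreasing_descents a x :
  (forall i, a <= i < n -> D_desc i x) ->
  forall z z', a <= z -> z < z' -> z' <= n -> at_pos x z' < at_pos x z.
Proof.
move=> dx z z' leaz; elim: z' => // z' IHz' ltzz' ltz'n.
have [i def_i] := ord_at (ltnW ltz'n).
have := dx i; rewrite D_descentE def_i root_fst_lt // => /(_ _) lt.
have {}lt : at_pos x z'.+1 < at_pos x z' by apply: lt; lia.
move: ltzz'; rewrite ltnS leq_eqVlt => /orP[/eqP-> //|ltzz'].
by apply: ltn_trans lt (IHz' ltzz' _); lia.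
Qed.

(** The descents make the value at [n.-1] exceed those at [n] and at the opposite position [n.+1],
    so it is above [n]; earlier positions have still larger values. The sign at [n] itself stays
    open. *)
Lemma last_descent_minus a w z : a <= n.-1 ->
  (forall i, a <= i -> D_desc i (evw w)) ->
  a <= z < n -> n < at_pos (evw w) z.
Proof.
move=> lea dx /andP[leaz ltzn]; have [i def_i] := ord_at (leqnn n).
have := dx i; rewrite D_descentE def_i root_fst_last at_pos_mid => /(_ _) lt1.
have dec := decreasing_descents (fun i (H : a <= i < n) => dx i (proj1 (andP H))).
have lt2 := dec n.-1 n lea; have lt3 := dec z n.-1 leaz.
have [->|neq] := eqVneq z n.-1; lia.
Qed.

Lemma last_descent_max a w z : a <= n.-1 ->
  (forall i, a <= i -> D_desc i (evw w)) ->
  a < z < n.*2.+1 - a -> at_pos (evw w) z < at_pos (evw w) a.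
Proof.
move=> lea dx /andP[ltaz ltz].
have dec := decreasing_descents (fun i (H : a <= i < n) => dx i (proj1 (andP H))).
have minus := last_descent_minus lea dx.
have [lezn|ltnz] := leqP z n; first exact: dec.
have gta : n < at_pos (evw w) a by apply: minus; lia.
have [eq_z|neq_z] := eqVneq z n.+1; last first.
  have := at_pos_rev w (_ : z <= n.*2.+1) => /(_ _) rz.
  by have := minus (n.*2.+1 - z); rewrite rz; lia.
have [i def_i] := ord_at (leqnn n).
have := dx i; rewrite D_descentE def_i root_fst_last eq_z => /(_ _) lt1.
have [<-|neq] := eqVneq n.-1 a; first by apply: lt1; lia.
by have := dec a n.-1 (leqnn a); lia.
Qed.

(** On a window symmetric about the middle the largest value can only sit at [a]: the opposite end
    holds a value at most [n]. *)
Lemma descents_top a w v : a <= n.-1 ->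
  (forall i, a <= i -> D_desc i (evw w)) -> n < v <= n.*2.+1 ->
  (exists2 z, a <= z <= n.*2.+1 - a & at_pos (evw w) z = v) ->
  (forall z, a <= z <= n.*2.+1 - a -> at_pos (evw w) z <= v) ->
  at_pos (evw w) a = v.
Proof.
move=> lea dx /andP[gtv lev] [z /andP[leaz lez] def_v] maxv.
have gta : n < at_pos (evw w) a by apply: (last_descent_minus lea dx); lia.
have [eq_z|neq_z] := eqVneq z a; first by rewrite -eq_z.
have leva : at_pos (evw w) a <= v by apply: maxv; lia.
have [eq_z'|neq_z'] := eqVneq z (n.*2.+1 - a).
  by move: def_v; rewrite eq_z' at_pos_rev; lia.
have := @last_descent_max a w z lea dx; rewrite def_v; lia.
Qed.

Lemma hv_word h : exists w, hv h = evw w.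
Proof. exact: (hval_word mod). Qed.

(** A star product by an element of the submonoid on [J] is a group product by some word over [J],
    so closure under left multiplication by generators suffices. *)
Lemma hsub_ind J (P : {perm pos} -> Prop) h h' :
  (forall i w, i \in J -> P (evw w) -> P (evw (i :: w))) ->
  hsub J h -> P (hv h') -> P (hv (h * h')).
Proof.
move=> PJ [u su <-]; rewrite (hvalM mod); have [w ->] := hv_word h' => Pw.
suff [v [-> //]] : exists v, lstarw D_gen D_desc u (evw w) = evw v /\ P (evw v).
elim: u su => [|i u IHu] su; first by exists w.
have [|v [/= -> Pv]] := IHu; first by move=> k ku; apply: su; rewrite inE ku orbT.
rewrite /lstar; case: ifP => _; [by exists v | exists (i :: v); split=> //].
by apply: PJ => //; apply: su; rewrite mem_head.
Qed.

Lemma hzero_descent J h h' i :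
  hzero J h -> i \in J -> D_desc i (hv (h * h')).
Proof.
move=> [_ hJ] /hJ[ih _]; apply/(hgenM_absorb mod).
by rewrite mulgA ih.
Qed.

(* As positions above [n] encode opposites of basis vectors, [minus x z] says
   that the signed permutation [x] changes the sign of coordinate [z]. *)
Definition minus x z : bool := n < at_pos x z.
Definition minus_init x : nat := \sum_(z < n) minus x z.
Definition minus_count x : nat := minus_init x + minus x n.
(* The analogue of [minus_count] for the other parabolic subgroup of type A_n,
   obtained by changing the sign of the last coordinate. *)
Definition minus_cocount x : nat := minus_init x + ~~ minus x n.

Lemma minus_gen i x z : z <= n.*2.+1 ->
  minus (D_gen i * x) z = minus x (dswap n i z).
Proof. by move=> lez; rewrite /minus at_pos_gen. Qed.

Lemma minus_rev w z : z <= n.*2.+1 ->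
  minus (evw w) (n.*2.+1 - z) = ~~ minus (evw w) z.
Proof.
move=> lez; rewrite /minus at_pos_rev //.
by have := at_pos_le (evw w) z; case: leqP; lia.
Qed.

Lemma sum_swap (m a : nat) (F F' : nat -> nat) : a.+1 < m ->
  F' a = F a.+1 -> F' a.+1 = F a ->
  (forall z, z < m -> z != a -> z != a.+1 -> F' z = F z) ->
  \sum_(z < m) F' z = \sum_(z < m) F z.
Proof.
move=> ltam F'a F'a1 F'z.
pose oa := Ordinal (ltnW ltam); pose ob := Ordinal ltam.
have neq : ob != oa by rewrite -(inj_eq val_inj) /=; lia.
rewrite !(bigD1 (P := xpredT) oa) //= !(bigD1 (P := fun k : 'I_m => k != oa) ob) //=.
rewrite F'a F'a1 addnCA; congr (_ + (_ + _)).
apply: eq_bigr => z /andP[nza nzb]; apply: F'z => //.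
Qed.

Lemma dswap_lowE i z : i < n -> z <= n ->
  dswap n i z = if z == i then i.+1 else if z == i.+1 then i : nat else z.
Proof.
move=> ltin lezn; have lein := leq_ord i; have rfi := root_fst_lt ltin.
case: eqP => [->|/eqP n1]; first by rewrite -{2}rfi dswap_fst.
case: eqP => [->|/eqP n2]; first by rewrite dswap_snd.
by rewrite dswap_fix ?rfi //; lia.
Qed.

Lemma dswap_last (i : 'I_n.+1) z : i = n :> nat -> z <= n ->
  dswap n i z = if z == n.-1 then n.+1 else if z == n then n.+2 else z.
Proof.
move=> ein lezn; have lein := leq_ord i.
have rfi : root_fst n i = n.-1 by rewrite ein root_fst_last.
case: eqP => [->|/eqP n1]; first by rewrite -{1}rfi dswap_fst ein.
case: eqP => [->|/eqP n2]; last by rewrite dswap_fix ?rfi //; lia.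
have -> : dswap n i n = dswap n i (n.*2.+1 - i.+1).
  by congr (dswap n i _); lia.
by rewrite dswap_rev ?dswap_snd //; lia.
Qed.

Lemma minus_init_gen i w : i < n.-1 ->
  minus_init (evw (i :: w)) = minus_init (evw w) /\
  minus (evw (i :: w)) n = minus (evw w) n.
Proof.
move=> lti; have ltin : i < n by lia.
have E z : z <= n -> minus (evw (i :: w)) z = minus (evw w) (dswap n i z).
  by move=> lez; apply: minus_gen; lia.
split; last by rewrite E // dswap_lowE //; do 2?case: eqP; lia.
apply: (@sum_swap n i (fun z => minus (evw w) z) (fun z => minus (evw (i :: w)) z));
  first by lia.
- by rewrite E ?dswap_lowE ?eqxx //; lia.
- by rewrite E ?dswap_lowE ?eqxx ?gtn_eqF //; lia.
by move=> z ltz n1 n2; rewrite E ?dswap_lowE ?(negPf n1) ?(negPf n2) //; lia.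
Qed.

Lemma minus_init_last x :
  minus_init x = \sum_(z < n.-1) minus x z + minus x n.-1.
Proof.
rewrite /minus_init; case: (n) gt2n => [//|n' _] /=.
by rewrite big_ord_recr.
Qed.

Lemma minus_count_gen i w :
  i < n -> minus_count (evw (i :: w)) = minus_count (evw w).
Proof.
move=> ltin; have E z : z <= n ->
    minus (evw (i :: w)) z = minus (evw w) (dswap n i z).
  by move=> lez; apply: minus_gen; lia.
have [lti|gei] := ltnP i n.-1.
  by rewrite /minus_count; have [-> ->] := minus_init_gen w lti.
have ein : i = n.-1 :> nat by lia.
have len1 : n.-1 <= n by lia.
rewrite /minus_count !minus_init_last !E ?dswap_lowE //.
have e1 : (n == n.-1) = false by apply/eqP; lia.
have e2 : n == n.-1.+1 by apply/eqP; lia.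
rewrite ein eqxx e1 e2 (eq_bigr (fun z : 'I_n.-1 => minus (evw w) z : nat)).
  by rewrite -(eqP e2) addnAC.
move=> z _; have ltz := ltn_ord z; have lezn : z <= n by lia.
by rewrite E ?dswap_lowE //; do 2?case: eqP => ?; lia.
Qed.

Lemma minus_last_gen i w : i = n :> nat ->
  [/\ \sum_(z < n.-1) minus (evw (i :: w)) z = \sum_(z < n.-1) minus (evw w) z,
      minus (evw (i :: w)) n.-1 = ~~ minus (evw w) n &
      minus (evw (i :: w)) n = ~~ minus (evw w) n.-1].
Proof.
move=> ein; have E z : z <= n ->
    minus (evw (i :: w)) z = minus (evw w) (dswap n i z).
  by move=> lez; apply: minus_gen; lia.
have len1 : n.-1 <= n by lia.
have m1 : minus (evw w) n.+1 = ~~ minus (evw w) n.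
  by rewrite -minus_rev; [congr (minus _ _)|]; lia.
have m2 : minus (evw w) n.+2 = ~~ minus (evw w) n.-1.
  by rewrite -minus_rev; [congr (minus _ _)|]; lia.
have e1 : (n == n.-1) = false by apply/eqP; lia.
split; last 2 first.
- by rewrite E ?dswap_last ?eqxx.
- by rewrite E ?dswap_last ?eqxx ?e1.
apply: eq_bigr => z _; have ltz := ltn_ord z; have lezn : z <= n by lia.
by rewrite E ?dswap_last //; do 2?case: eqP => ?; lia.
Qed.

Lemma minus_cocount_gen i w :
  i != n.-1 :> nat -> minus_cocount (evw (i :: w)) = minus_cocount (evw w).
Proof.
move=> nin; have [lti|gei] := ltnP i n.-1.
  by rewrite /minus_cocount; have [-> ->] := minus_init_gen w lti.
have ein : i = n :> nat by have := ltn_ord i; lia.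
rewrite /minus_cocount !minus_init_last; have [-> -> ->] := minus_last_gen w ein.
by rewrite negbK -!addnA; congr addn; rewrite addnC.
Qed.

(** The last generator changes two signs and the others permute coordinates. In [hv_fe_count] this
    parity settles the sign of the last coordinate. *)
Lemma minus_count_even w : ~~ odd (minus_count (evw w)).
Proof.
elim: w => [|i w IHw].
  rewrite /minus_count /minus /= at_pos1 ?ltnn ?addn0; last by lia.
  rewrite /minus_init big1 // => z _.
  by rewrite /minus at_pos1; have := ltn_ord z; lia.
have [ltin|gein] := ltnP i n; first by rewrite minus_count_gen.
have ein : i = n :> nat by have := ltn_ord i; lia.
move: IHw; rewrite /minus_count !minus_init_last.
have [-> -> ->] := minus_last_gen w ein.
by rewrite !oddD; case: (minus _ n.-1); case: (minus _ n); case: (odd _).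
Qed.

Definition D_low : {set 'I_n.+1} := [set i : 'I_n.+1 | i < n]%SET.

(** Right absorption makes the inverse decreasing on the positions up to [n]. Passing to opposites,
    the values above [n] decrease along the positions, so the signs alone force every left
    descent. *)
Lemma top_zero h : (forall i, i < n -> h * hgen (D n) i = h) ->
  (forall z, z < n -> minus (hv h) z) -> hzero [set: 'I_n.+1]%SET h.
Proof.
move=> hr hminus; apply: hzero_left; first exact: hsub_setT.
move=> i _; apply/(hgenM_absorb mod).
have [w eq_w] := hv_word h; rewrite eq_w in hminus *.
set y := evw w in hminus *.
have Vdec v v' : v < v' -> v' <= n -> at_pos y^-1 v' < at_pos y^-1 v.
  have [u eq_u] : exists u, y^-1 = evw u.
    by exists (rev w); rewrite (wordval_rev (D_gen_sqr gt2n)).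
  move=> ltv lev; apply: (@decreasing_descents 0) => // j /andP[_ ltj].
  by have /(hgenMr_absorb mod) := hr j ltj; rewrite eq_w.
have dec z z' : z < z' -> z' <= n.+1 -> z < n -> n < at_pos y z' ->
    at_pos y z' < at_pos y z.
  move=> ltzz' lez' ltzn gtz'; rewrite ltnNge; apply/negP => le_zz'.
  have gtz := hminus z ltzn.
  have neq : at_pos y z <> at_pos y z' by move/at_pos_inj; lia.
  have Vat t : t <= n.*2.+1 -> at_pos y^-1 (n.*2.+1 - at_pos y t) = n.*2.+1 - t.
    move=> let_; rewrite -at_pos_rev //.
    by rewrite /at_pos inord_val permK inordK //; lia.
  have := Vdec (n.*2.+1 - at_pos y z') (n.*2.+1 - at_pos y z).
  have := at_pos_le y z; have := at_pos_le y z'.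
  by move: gtz; rewrite !Vat /minus; lia.
have lti := ltn_ord i; rewrite D_descentE.
have [ltin|gein] := ltnP i n.
  rewrite root_fst_lt //; have gti := hminus i ltin.
  have [gt|le] := ltnP n (at_pos y i.+1); first by apply: dec => //; lia.
  by apply: leq_ltn_trans le gti.
have ein : i = n :> nat by lia.
rewrite ein root_fst_last.
have gtn1 : minus y n.-1 by apply: hminus; lia.
have [gt|le] := ltnP n (at_pos y n.+1); first by apply: dec => //; lia.
exact: leq_ltn_trans le gtn1.
Qed.

Lemma zero_top h : hzero [set: 'I_n.+1]%SET h ->
  (forall z, z < n -> minus (hv h) z) /\ at_pos (hv h) 0 = n.*2.+1.
Proof.
move=> h0.
have dh i : 0 <= i -> D_desc i (hv h).
  by move=> _; rewrite -[h]mulg1; apply: (hzero_descent _ h0); rewrite inE.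
have [w eq_w] := hv_word h; rewrite eq_w in dh *; split.
  by move=> z ltz; apply: (last_descent_minus (leq0n _) dh).
apply: (descents_top (leq0n _) dh); first lia.
  have [//|z ltz ez] := @at_pos_surj (evw w) n.*2.+1; exists z => //; lia.
by move=> z _; apply: at_pos_le.
Qed.

Lemma hv_minus_count J h h' : J \subset D_low -> hsub J h ->
  minus_count (hv (h * h')) = minus_count (hv h').
Proof.
move=> /fintype.subsetP sJ hJ.
apply: (hsub_ind (P := fun x => minus_count x = minus_count (hv h'))) hJ _ => //.
by move=> i w /sJ; rewrite inE => lti; rewrite minus_count_gen.
Qed.

Lemma hv_minus_cocount J h h' : (forall i, i \in J -> i != n.-1 :> nat) ->
  hsub J h -> minus_cocount (hv (h * h')) = minus_cocount (hv h').
Proof.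
move=> sJ hJ.
apply: (hsub_ind (P := fun x => minus_cocount x = minus_cocount (hv h'))) hJ _ => //.
by move=> i w /sJ nin; rewrite minus_cocount_gen.
Qed.

Lemma hv1 : hv (1 : hecke (D n)) = 1.
Proof. exact: (hval1 mod). Qed.

Lemma minus_init1 : minus_init (1 : {perm pos}) = 0.
Proof.
rewrite /minus_init big1 // => z _.
by rewrite /minus at_pos1; have := ltn_ord z; lia.
Qed.

Lemma minus_count1 : minus_count (1 : {perm pos}) = 0.
Proof. by rewrite /minus_count minus_init1 /minus at_pos1 ?ltnn; lia. Qed.

(* [minus_count] and [minus_cocount] differ by at most 1, so that each factor
   creates at most two negative coordinates. *)
Lemma type_A_not_zero J (K : {set 'I_n.+1}) (e f : hecke (D n)) :
  3 < n -> J \subset D_low ->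
  (forall i, i \in K -> i != n.-1 :> nat) -> hsub J e -> hsub K f ->
  ~ hzero [set: 'I_n.+1]%SET (f * e * f * e).
Proof.
move=> gt3n sJ sK eJ fK /zero_top[top _].
have diff x : minus_cocount x <= (minus_count x).+1 /\
    minus_count x <= (minus_cocount x).+1.
  by rewrite /minus_cocount /minus_count; case: (minus x n); lia.
have c1 : minus_count (hv e) = 0.
  by rewrite -[e]mulg1 (hv_minus_count _ sJ eJ) hv1 minus_count1.
have c2 := hv_minus_cocount e sK fK.
have c3 := hv_minus_count (f * e) sJ eJ.
have c4 := hv_minus_cocount (e * (f * e)) sK fK.
rewrite !mulgA in c3 c4.
have [d1 _] := diff (hv e); have [_ d2] := diff (hv (f * e)).
have [d3 _] := diff (hv (e * f * e)).
suff : n <= minus_cocount (hv (f * e * f * e)).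
  rewrite c2 in d2; rewrite c1 in d1; rewrite c3 in d3.
  have le2 : minus_count (hv (f * e)) <= 2 by apply: leq_trans d2 _.
  have le3 : minus_cocount (hv (e * f * e)) <= 3 by apply: leq_trans d3 _.
  by rewrite c4 => /leq_trans/(_ le3); lia.
rewrite /minus_cocount /minus_init (eq_bigr (fun=> 1%N)) => [|z _].
  by rewrite sum1_card card_ord leq_addr.
by rewrite top.
Qed.

(** * Products of the longest elements e and f *)

Section TypeD.
Variables (k : nat) (e f : hecke (D n)).
Hypothesis k2n : 2 <= k <= n.
Hypothesis e0 : hzero (interval n.+1 1 n) e.
Hypothesis f0 : hzero (interval n.+1 k n.+1) f.

(** The number of negative coordinates of [fe]: [f] makes coordinates [k.-1] to [n.-1] negative and
    evenness settles coordinate [n], which rounds [n.+2 - k] down to an even number. *)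
Local Notation m := (n.+2 - k)./2.*2.

Lemma interval_low : interval n.+1 1 n = D_low.
Proof. by apply/setP=> i; rewrite !inE. Qed.

Lemma mem_low i : (i \in interval n.+1 1 n) = (i < n).
Proof. by rewrite interval_low inE. Qed.

Lemma mem_high i : (i \in interval n.+1 k n.+1) = (k.-1 <= i).
Proof. by rewrite inE; have := ltn_ord i; lia. Qed.

Lemma hv_e_count h : minus_count (hv (e * h)) = minus_count (hv h).
Proof. by apply: (hv_minus_count _ _ (proj1 e0)); rewrite interval_low. Qed.

(** The descents of [e] make the negative coordinates an initial segment, and [e] preserves their
    number. *)
Lemma hv_e_minus h z : z <= n -> minus (hv (e * h)) z = (z < minus_count (hv h)).
Proof.
move=> lez; rewrite -hv_e_count; set x := hv (e * h).
have dec z1 z2 : z1 < z2 -> z2 <= n -> minus x z2 -> minus x z1.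
  move=> lt12 le2; rewrite /minus => /ltn_trans; apply.
  apply: (@decreasing_descents 0) => // i /andP[_ lti].
  by apply: (hzero_descent _ e0); rewrite mem_low.
have -> : minus_count x = \sum_(t < n.+1) minus x t.
  by rewrite big_ord_recr.
have sumE p : p <= n.+1 -> (forall t, t < p -> minus x t) ->
    \sum_(t < n.+1) minus x t = p + \sum_(p <= t < n.+1) minus x t.
  move=> lep mp; rewrite -(big_mkord xpredT (fun t => minus x t : nat)).
  rewrite (@big_cat_nat _ _ _ p) //=; congr (_ + _).
  rewrite big_nat_cond (eq_bigr (fun=> 1%N)) => [|t /andP[/andP[_ /mp->]]] //.
  by rewrite -big_nat_cond sum_nat_const_nat muln1 subn0.
apply/idP/idP=> [mz|]; last first.
  apply: contraLR => nmz; rewrite -leqNgt.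
  rewrite -(big_mkord xpredT (fun t => minus x t : nat)).
  rewrite (@big_cat_nat _ _ _ z) //=; last by lia.
  rewrite [X in _ + X]big_nat_cond [X in _ + X]big1 => [|t /andP[/andP[lezt ltt] _]].
    rewrite addn0; apply: (@leq_trans (\sum_(0 <= t < z) 1%N)).
      by apply: leq_sum => t _; case: minus.
    by rewrite sum_nat_const_nat muln1 subn0.
  have [eq_zt|neq] := eqVneq z t; first by rewrite -eq_zt (negPf nmz).
  by case mt: (minus x t) => //; rewrite (dec z t) // in nmz; lia.
rewrite (@sumE z.+1) => //.
  by rewrite addSn ltnS leq_addr.
move=> t; rewrite ltnS leq_eqVlt => /orP[/eqP-> //|ltt].
exact: dec ltt lez mz.
Qed.

Lemma hv_e_init z : z <= n -> ~~ minus (hv e) z.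
Proof.
by move=> lez; rewrite -[e]mulg1 hv_e_minus // hv1 minus_count1 ltn0.
Qed.

Lemma hv_f_fix h z : z < k.-1 -> at_pos (hv (f * h)) z = at_pos (hv h) z.
Proof.
move=> ltz.
apply: (hsub_ind (P := fun x => at_pos x z = at_pos (hv h) z)) (proj1 f0) _ => //.
move=> i w; rewrite mem_high => lei <-; rewrite /= at_pos_gen; last by lia.
have lein := leq_ord i; have := root_fstE gt2n lein => rE.
by rewrite dswap_fix //; lia.
Qed.

Lemma hv_f_minus h z : k.-1 <= z < n -> minus (hv (f * h)) z.
Proof.
have [w eq_w] := hv_word (f * h).
rewrite eq_w; apply: last_descent_minus; first by lia.
by move=> i lei; rewrite -eq_w; apply: (hzero_descent _ f0); rewrite mem_high.
Qed.

Lemma hv_fe_count : minus_count (hv (f * e)) = m.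
Proof.
have [w eq_w] := hv_word (f * e).
have := minus_count_even w; rewrite -eq_w.
suff -> : minus_count (hv (f * e)) = n - k.-1 + minus (hv (f * e)) n.
  by case: (minus _ n); rewrite ?addn0 ?addn1; lia.
rewrite /minus_count; congr (_ + _).
rewrite /minus_init -(big_mkord xpredT (fun t => minus (hv (f * e)) t : nat)).
rewrite (@big_cat_nat _ _ _ k.-1) //=; last by lia.
rewrite big_nat_cond big1 => [|t /andP[/andP[_ ltt] _]]; last first.
  by rewrite /minus hv_f_fix //; have := @hv_e_init t; rewrite /minus; lia.
rewrite big_nat_cond (eq_bigr (fun=> 1%N)) => [|t /andP[/andP[le lt] _]].
  by rewrite -big_nat_cond sum_nat_const_nat muln1.
by rewrite hv_f_minus ?le.
Qed.

Lemma hv_efe_minus z : z <= n -> minus (hv (e * f * e)) z = (z < m).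
Proof. by move=> lez; rewrite -mulgA hv_e_minus // hv_fe_count. Qed.

Lemma e_right h i : i < n -> h * e * hgen (D n) i = h * e.
Proof.
by move=> lti; rewrite -mulgA; have [_ ->] := proj2 e0 i (etrans (mem_low i) lti).
Qed.

Lemma efe_zero : hzero [set: 'I_n.+1]%SET (e * f * e) <-> ~~ odd n /\ k = 2.
Proof.
split=> [/zero_top[top _]|[evn k2]].
  have := top n.-1; rewrite hv_efe_minus; last by lia.
  by lia.
apply: top_zero => [i lti|z ltz]; first exact: e_right.
by rewrite hv_efe_minus; lia.
Qed.

Lemma fefe_zero : hzero [set: 'I_n.+1]%SET (f * e * f * e) <-> k.-1 <= m.
Proof.
split=> [/zero_top[top _]|lek].
  (* Coordinate [k.-2] is the last one that [f] leaves in place, so there [fefe] agrees with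
     [efe]. *)
  have := top k.-2; rewrite /minus -!mulgA hv_f_fix; last by lia.
  rewrite -/(minus _ _) !mulgA hv_efe_minus; last by lia.
  by lia.
apply: top_zero => [i lti|z ltz]; first exact: e_right.
have [ltzk|lekz] := ltnP z k.-1; last by rewrite -!mulgA hv_f_minus // lekz.
by rewrite /minus -!mulgA hv_f_fix // -/(minus _ _) !mulgA hv_efe_minus; lia.
Qed.

Lemma hv_e_pos h v : (exists2 z, z <= n & at_pos (hv h) z = v) ->
  exists2 z, z <= n & at_pos (hv (e * h)) z = v.
Proof.
apply: (hsub_ind (P := fun x => exists2 z, z <= n & at_pos x z = v))
  (proj1 e0) => i w.
rewrite mem_low => lti [z lez ez].
have dlt : dswap n i z <= n by rewrite dswap_lowE //; do 2?case: eqP => ?; lia.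
exists (dswap n i z) => //; rewrite /= at_pos_gen; last by lia.
by rewrite dswapK //; have := leq_ord i; lia.
Qed.

Lemma hv_f0 : at_pos (hv f) 0 = 0.
Proof.
by rewrite -[f]mulg1 hv_f_fix ?hv1 ?at_pos1 //; lia.
Qed.

(** [f] has value 0 at position 0 and [e] permutes the positions up to [n], so [ef] attains 0 among
    them and [n.*2.+1] only beyond them. As [f] does not move position 0, the value there cannot be
    [n.*2.+1]. *)
Lemma fef_not_zero : ~ hzero [set: 'I_n.+1]%SET (f * e * f).
Proof.
move=> /zero_top[_]; rewrite -mulgA hv_f_fix; last by lia.
have [z lez ez] : exists2 z, z <= n & at_pos (hv (e * f)) z = 0.
  by apply: hv_e_pos; exists 0 => //; apply: hv_f0.
have [w eq_w] := hv_word (e * f); rewrite eq_w in ez *.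
move=> top0; have lezm : z <= n.*2.+1 by lia.
have := at_pos_rev w lezm; rewrite ez subn0 => rz.
by have := at_pos_inj _ _ (etrans rz (esym top0)); lia.
Qed.

(** Here [m] is [n.-1], so only the last two coordinates of [efe] are not negative, and the last
    reflection changes exactly these two signs. *)
Lemma gen_last_efe : k = 2 -> odd n ->
  hzero [set: 'I_n.+1]%SET (hgen (D n) ord_max * (e * f * e)).
Proof.
move=> k2 oddn; apply: top_zero => [i lti|z ltz].
  by rewrite mulgA e_right.
rewrite (hval_genM mod); have [w eq_w] := hv_word (e * f * e).
have mw t : t <= n -> minus (evw w) t = (t < n.-1).
  by move=> let_; rewrite -eq_w hv_efe_minus // k2; lia.
rewrite eq_w /lstar D_descentE /= root_fst_last at_pos_mid.
have m2 := mw n.-1; have m1 := mw n; rewrite /minus in m1 m2.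
case: ifP => [|_]; first by have := at_pos_le (evw w) n; lia.
have [[eq1 eq2 eq3]] := minus_last_gen w (erefl : (@ord_max n) = n :> nat).
have [eq_z|neq_z] := eqVneq z n.-1.
  by rewrite eq_z [minus _ _]eq2 mw ?ltnNge //; lia.
have [en lezn] : (z == n) = false /\ z <= n by split; [apply/eqP|]; lia.
by rewrite minus_gen ?dswap_last ?(negPf neq_z) ?en ?mw //; lia.
Qed.

Lemma at_pos_neq x z z' : z != z' -> z < n.*2.+2 -> z' < n.*2.+2 ->
  at_pos x z <> at_pos x z'.
Proof. by move=> /eqP neq ltz ltz' /at_pos_inj; apply: contra_not neq; exact. Qed.

(** The first two values of [fef] are [2n] and [2n+1], so [s_1] is the only missing descent;
    multiplying by it exchanges them. *)
Lemma gen_first_fef : k = 2 ->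
  hzero [set: 'I_n.+1]%SET (hgen (D n) ord0 * (f * e * f)).
Proof.
move=> k2; have le1 : 1 <= n.-1 by lia.
have df h i : 1 <= i -> D_desc i (hv (f * h)).
  by move=> lei; apply: (hzero_descent _ f0); rewrite mem_high k2.
(* Position 0 keeps the value 0, so [2n+1] sits at the opposite end and [2n] is the largest value
   left for position 1. *)
have f1 : at_pos (hv f) 1 = n.*2.
  have := df 1; rewrite mulg1; have := hv_f0.
  have [w ->] := hv_word f => w0 dw.
  have wm : at_pos (evw w) n.*2.+1 = n.*2.+1.
    by rewrite -[X in at_pos _ X]subn0 at_pos_rev // w0 subn0.
  apply: (descents_top le1 dw); first by lia.
    have [|z ltz ez] := @at_pos_surj (evw w) n.*2; first by lia.
    exists z => //; have [ez0|] := eqVneq z 0; first by rewrite ez0 in ez; lia.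
    by have [ezm|] := eqVneq z n.*2.+1; [rewrite ezm in ez|]; lia.
  move=> z ltz; have := @at_pos_neq (evw w) z n.*2.+1; rewrite wm.
  by have := at_pos_le (evw w) z; lia.
(* [e] moves the largest value on the positions up to [n] to the front; it is [2n], since [2n+1] is
   opposite to the value 0 found among them. *)
have ef0 : at_pos (hv (e * f)) 0 = n.*2.
  have [|z lez ez] := @hv_e_pos f n.*2; first by exists 1%N; rewrite ?f1; lia.
  have [|z' lez' ez'] := @hv_e_pos f 0; first by exists 0; rewrite ?hv_f0.
  have dec z1 : 0 < z1 -> z1 <= n ->
      at_pos (hv (e * f)) z1 < at_pos (hv (e * f)) 0.
    move=> lt1 le1n; apply: (@decreasing_descents 0) => // i /andP[_ lti].
    by apply: (hzero_descent _ e0); rewrite mem_low.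
  have [w eq_w] := hv_word (e * f); rewrite eq_w in ez ez' dec *.
  have lezm : z' <= n.*2.+1 by lia.
  have := at_pos_rev w lezm; rewrite ez' subn0 => rz.
  have := @at_pos_neq (evw w) 0 (n.*2.+1 - z'); rewrite rz.
  have := at_pos_le (evw w) 0; have [eqz|neqz] := eqVneq z 0.
    by move=> *; move: ez; rewrite eqz.
  by have := dec z; lia.
have fef0 : at_pos (hv (f * e * f)) 0 = n.*2.
  by rewrite -mulgA hv_f_fix ?ef0 //; lia.
have [w eq_w] := hv_word (f * e * f).
have dw i : 1 <= i -> D_desc i (evw w) by rewrite -eq_w -mulgA; apply: df.
rewrite eq_w in fef0.
(* The outer positions hold [2n] and 1, so [2n+1] lies in the window from 1 to [2n] and the descents
   of [f] put it at 1. *)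
have fef1 : at_pos (evw w) 1 = n.*2.+1.
  apply: (descents_top le1 dw); first by lia.
    have [|z ltz ez] := @at_pos_surj (evw w) n.*2.+1; first by lia.
    exists z => //; have [ez0|] := eqVneq z 0; first by rewrite ez0 in ez; lia.
    have [ezm|] := eqVneq z n.*2.+1; last by lia.
    move: ez; rewrite ezm -[X in at_pos _ X]subn0 at_pos_rev // fef0; lia.
  by move=> z _; apply: at_pos_le.
apply: hzero_left; first exact: hsub_setT.
move=> i _; apply/(hgenM_absorb mod); rewrite (hval_genM mod) eq_w.
have r0 : root_fst n (ord0 : 'I_n.+1) = 0 by rewrite root_fst_lt //=; lia.
rewrite /lstar [D_desc ord0 _]D_descentE r0 fef0 fef1 ltnNge leqnSn /=.
rewrite D_descentE; have lei := leq_ord i.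
rewrite !at_pos_gen; [|have := root_fst_le gt2n lei; lia..].
have d0 : dswap n 0 0 = 1%N by rewrite -{2}(root_fst_lt (_ : 0 < n)) ?dswap_fst //; lia.
have d1 : dswap n 0 1 = 0 by rewrite dswap_snd ?root_fst_lt //; lia.
have dF z : 1 < z -> z <= n.+1 -> dswap n 0 z = z.
  by move=> gtz lez; rewrite dswap_fix ?root_fst_lt //; lia.
have rE := root_fstE gt2n lei.
have [i0|ni0] := eqVneq (i : nat) 0.
  by rewrite i0 root_fst_lt ?d0 ?d1 ?fef0 ?fef1 //; lia.
have [i1|ni1] := eqVneq (i : nat) 1%N.
  rewrite i1 root_fst_lt ?d1 ?dF //; try lia; rewrite fef0.
  have := @at_pos_neq (evw w) 2 0; have := @at_pos_neq (evw w) 2 1%N.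
  by rewrite fef0 fef1; have := at_pos_le (evw w) 2; lia.
by rewrite !dF; try lia; apply: dw; lia.
Qed.

End TypeD.

End DComputations.

(** * Homomorphisms of Hecke monoids *)

Section Lift.
Variables (I' : finType) (M' : coxeterMatrix I').

Lemma morphism_hclass (N : monoidType) (phi : hecke M' -> N) w :
  monoid_morphism phi ->
  phi (hclass M' w) = wordval (fun i => phi (hgen M' i)) w.
Proof.
move=> [phi1 phiM]; elim: w => [|i w IHw]; first exact: phi1.
by rewrite -cat1s -hclassM phiM IHw.
Qed.

Lemma morphism_eq (N : monoidType) (phi psi : hecke M' -> N) :
  monoid_morphism phi -> monoid_morphism psi ->
  (forall i, phi (hgen M' i) = psi (hgen M' i)) -> phi =1 psi.
Proof.
move=> mphi mpsi e h; rewrite -(hclassE h) !morphism_hclass //.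
by elim: (repr h) => //= i w ->; rewrite e.
Qed.

Lemma hecke_lift (N : monoidType) (c : I' -> N) :
  (forall i, c i * c i = c i) ->
  (forall i j, i != j -> M' i j != 0 -> wordval c (alternating i j (M' i j)) =
    wordval c (alternating j i (M' i j))) ->
  exists2 phi : hecke M' -> N, monoid_morphism phi &
    forall i, phi (hgen M' i) = c i.
Proof.
move=> cc cb; pose phi (h : hecke M') := wordval c (repr h).
have phiE w : phi (hclass M' w) = wordval c w.
  have /pclassE := hclassE (hclass M' w).
  apply: congruence_invariant => a b _ _ [i|i j neq_ij Mij];
    rewrite !wordval_cat; congr (_ * (_ * _)).
    by rewrite /= !mulg1 cc.
  exact: cb.
exists phi; last by move=> i; rewrite phiE /= mulg1.
split; first exact: (phiE [::]).
by move=> x y; rewrite -(hclassE x) -(hclassE y) hclassM !phiE wordval_cat.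
Qed.

Lemma hecke_diagram (tau : {perm I'}) : is_diagram_perm M' tau ->
  exists2 theta : hecke M' -> hecke M', is_diagram_automorphism theta &
    forall w, theta (hclass M' w) = hclass M' (map tau w).
Proof.
move=> Mtau; have val_map w :
    wordval (fun i => hgen M' (tau i)) w = hclass M' (map tau w).
  by elim: w => //= i w ->; rewrite hclassM.
have alt_map i j m : map tau (alternating i j m) = alternating (tau i) (tau j) m.
  by elim: m i j => // m IHm i j; rewrite !alternatingS /= IHm.
have [|i j neq_ij Mij|theta mtheta thetaE] :=
    @hecke_lift (hecke M') (fun i => hgen M' (tau i)).
- by move=> i; apply: hgen_idem.
- rewrite !val_map !alt_map -Mtau; apply/pclassE.
  have := CongrRel [::] [::] (@HeckeBraid _ M' (tau i) (tau j) _ _).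
  by rewrite !cats0 /=; apply; rewrite ?(inj_eq perm_inj) ?Mtau.
exists theta; first by split => //; exists tau.
move=> w; rewrite morphism_hclass // -val_map.
by elim: w => //= i w ->; rewrite thetaE.
Qed.

Lemma hzero_diagram (tau : {perm I'}) theta (J : {set I'}) z :
  (forall w, theta (hclass M' w) = hclass M' (map tau w)) ->
  hzero J z -> hzero (tau @: J)%SET (theta z).
Proof.
move=> thetaE [[w sw <-] zJ]; split.
  exists (map tau w) => // k /mapP[i /sw iJ ->]; exact: imset_f.
move=> _ /imsetP[i iJ ->]; have [iz zi] := zJ i iJ.
rewrite thetaE -[hgen M' (tau i)]/(hclass M' (map tau [:: i])).
rewrite !hclassM -!map_cat -!thetaE.
by split; congr theta; rewrite -hclassM.
Qed.

Lemma connected_diagram (tau : {perm I'}) (J : {set I'}) :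
  is_diagram_perm M' tau ->
  connected_subset M' J -> connected_subset M' (tau @: J)%SET.
Proof.
move=> Mtau cJ _ _ /imsetP[i iJ ->] /imsetP[j jJ ->].
have /connectP[p pp ->] := cJ i j iJ jJ.
elim: p i {iJ} pp => [|k p IHp] i /=; first by rewrite connect0.
move=> /andP[/and3P[iJ kJ adj] /IHp]; apply: connect_trans.
by apply: connect1; rewrite /= !imset_f //= /cox_adj /= !Mtau.
Qed.

End Lift.

(** * Supports of idempotents and images of zeros *)

Section Support.
Variables (I' I : finType) (M' : coxeterMatrix I') (M : coxeterMatrix I).
Variables (G : finGroupType) (g : I -> G) (D : I -> G -> bool).
Hypothesis mod : descent_model M g D.
Variable phi : hecke M' -> hecke M.
Hypothesis mphi : monoid_morphism phi.

Lemma hzero_hsupp i : hzero (hsupp phi i) (phi (hgen M' i)).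
Proof.
apply: (idempotent_hzero mod).
by have [_ phiM] := mphi; rewrite -phiM hgen_idem.
Qed.

Lemma hzero_support (J : {set I}) (h : hecke M) : hzero J h -> hecke_support h = J.
Proof.
move=> [[w sw <-] wJ]; apply/setP => i; rewrite (mem_hecke_support mod).
apply/idP/idP => [/sw //|/wJ[+ _]].
by rewrite hclassM => /hclass_mem <-; rewrite mem_head.
Qed.

(** Morphisms preserve zeros: a letter in the support of [phi (hgen M' i)] is absorbed by this
    idempotent, which is in turn absorbed by [phi z]. *)
Lemma hzero_hsupps (K : {set I'}) z : hzero K z -> hzero (hsupps phi K) (phi z).
Proof.
have [phi1 phiM] := mphi.
move=> [[w sw <-] zK]; apply: hzero_left.
  elim: w sw {zK} => [|i w IHw] sw; first by rewrite hclass1 phi1; apply: hsub1.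
  rewrite -cat1s -hclassM phiM; apply: hsubM; last first.
    by apply: IHw => k kw; apply: sw; rewrite inE kw orbT.
  apply: hsub_subset (proj1 (hzero_hsupp i)).
  by apply: finset.bigcup_sup; apply: sw; rewrite mem_head.
move=> j /finset.bigcupP[i iK ji]; have [iz _] := zK i iK.
rewrite -iz phiM mulgA; congr (_ * _).
by have [_ /(_ j ji)[]] := hzero_hsupp i.
Qed.

End Support.

(** * Homomorphisms out of the Hecke monoid of B2 *)

Section FromB2.

Local Notation a := (ord0 : 'I_2).
Local Notation b := (ord_max : 'I_2).
Local Notation hB := (hclass B2).
Local Notation hv2 := (hval B2_gen B2_descent).
Local Notation ls2 := (lstarw B2_gen B2_descent).

Lemma I2_case (P : 'I_2 -> Prop) : P a -> P b -> forall i, P i.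
Proof.
by move=> Pa Pb [[|[|]] //= lti2]; [move: Pa | move: Pb];
  congr P; apply: val_inj.
Qed.

Lemma I2_subsets (J K : {set 'I_2}) :
  J \subset K -> J != finset.set0 -> J != K ->
  K = [set: 'I_2]%SET /\ (J = finset.set1 a \/ J = finset.set1 b).
Proof.
have ext (X Y : {set 'I_2}) :
    (a \in X) = (a \in Y) -> (b \in X) = (b \in Y) -> X = Y.
  by move=> Xa Xb; apply/setP; elim/I2_case.
move=> /fintype.subsetP sJK n0 nJK.
have := sJK a; have := sJK b.
case aJ: (a \in J); case bJ: (b \in J) => sb sa.
- by case/eqP: nJK; apply: ext; rewrite ?aJ ?bJ ?sa ?sb.
- case bK: (b \in K).
    by split; [|left]; apply: ext; rewrite !inE ?aJ ?bJ ?sa ?bK.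
  by case/eqP: nJK; apply: ext; rewrite ?aJ ?bJ ?sa ?bK.
- case aK: (a \in K).
    by split; [|right]; apply: ext; rewrite !inE ?aJ ?bJ ?sb ?aK.
  by case/eqP: nJK; apply: ext; rewrite ?aJ ?bJ ?sb ?aK.
by case/eqP: n0; apply: ext; rewrite inE ?aJ ?bJ.
Qed.

Lemma B2_zero : hzero [set: 'I_2]%SET (hB [:: a; b; a; b]).
Proof.
apply: hzero_left; first exact: hsub_setT.
move=> i _; apply/(hgenM_absorb B2_model); rewrite (hval_hclass B2_model).
by elim/I2_case: i.
Qed.

Lemma B2_braid : hB [:: b; a; b; a] = hB [:: a; b; a; b].
Proof. exact: (hzero_rev B2_zero). Qed.

(* Two distinct elements of the monoid are separated by a left factor which
   takes one of them to the top element and the other to a coatom. *)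
Lemma B2_separation (x y : signed2) : x <> y ->
  let sep (x y : signed2) (u : seq 'I_2) :=
    (ls2 u x \in [:: ls2 [:: a; b; a] 1; ls2 [:: b; a; b] 1]) &&
    (ls2 u y == ls2 [:: a; b; a; b] 1) in
  has (fun u => sep x y u || sep y x u)
    [:: [::]; [:: a]; [:: b]; [:: a; b]; [:: b; a]; [:: a; b; a]; [:: b; a; b]].
Proof. by move: x y => [[[] []] []] [[[] []] []]. Qed.

Section Injectivity.
Variables (N : monoidType) (phi : hecke B2 -> N).
Hypothesis mphi : monoid_morphism phi.

(** By [B2_separation], left multiplication carries a collision of two elements to one between the
    top and a coatom. *)
Lemma B2_injective :
  phi (hB [:: a; b; a]) <> phi (hB [:: a; b; a; b]) ->
  phi (hB [:: b; a; b]) <> phi (hB [:: a; b; a; b]) -> injective phi.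
Proof.
move=> naba nbab; have [_ phiM] := mphi.
have sep h h' u : phi h = phi h' ->
    (ls2 u (hv2 h) \in [:: ls2 [:: a; b; a] 1; ls2 [:: b; a; b] 1]) &&
    (ls2 u (hv2 h') == ls2 [:: a; b; a; b] 1) -> False.
  move=> ehh'; rewrite -!(hvalM B2_model) -!(hval_hclass B2_model) !inE.
  case/andP=> eh /eqP/(hval_inj B2_model) eh'.
  have e : phi (hB u * h) = phi (hB [:: a; b; a; b]) by rewrite -eh' !phiM ehh'.
  by case/orP: eh => /eqP/(hval_inj B2_model) eh; rewrite eh in e.
move=> h h' ehh'; apply: (hval_inj B2_model).
have [//|/eqP neq] := eqVneq (hv2 h) (hv2 h').
have /hasP[u _ /orP[S|S]] := B2_separation neq.
  by case: (sep _ _ _ ehh' S).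
by case: (sep _ _ _ (esym ehh') S).
Qed.

End Injectivity.

Lemma B2_aba_neq : hB [:: a; b; a] <> hB [:: a; b; a; b].
Proof. by move=> /(congr1 hv2); rewrite !(hval_hclass B2_model). Qed.

Lemma B2_bab_neq : hB [:: b; a; b] <> hB [:: a; b; a; b].
Proof. by move=> /(congr1 hv2); rewrite !(hval_hclass B2_model). Qed.

Lemma to_hecke_w0_B2 : to_hecke (w0 B2 [set: 'I_2]%SET) = hB [:: a; b; a; b].
Proof. exact: (hzero_uniq (hzero_w0 B2_model _) B2_zero). Qed.

Lemma wpair_B2_a :
  to_hecke (wpair B2 (finset.set1 a) [set: 'I_2]%SET) = hB [:: b; a; b].
Proof.
rewrite /wpair (w0_set1 B2_model); apply: (to_hecke_cgenM B2_model);
  rewrite to_hecke_w0_B2.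
  by rewrite hclassM.
exact: B2_bab_neq.
Qed.

Lemma wpair_B2_b :
  to_hecke (wpair B2 (finset.set1 b) [set: 'I_2]%SET) = hB [:: a; b; a].
Proof.
rewrite /wpair (w0_set1 B2_model); apply: (to_hecke_cgenM B2_model);
  rewrite to_hecke_w0_B2.
  by rewrite hclassM B2_braid.
exact: B2_aba_neq.
Qed.

Lemma B2_diagram (tau : {perm 'I_2}) : is_diagram_perm B2 tau.
Proof. by move=> i j; rewrite /= /B2_entry (inj_eq perm_inj). Qed.

End FromB2.

(** * Diagram symmetry and connected subsets in type D *)

Section DDiagram.
Variable n : nat.
Hypothesis gt2n : 2 < n.

Local Notation fork := (inord n.-1 : 'I_n.+1).
Implicit Types (i j z : 'I_n.+1) (X : {set 'I_n.+1}).

Lemma val_fork : fork = n.-1 :> nat.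
Proof. by rewrite inordK //; lia. Qed.

Lemma val_sigma i : D_sigma n i =
  (if i == n.-1 :> nat then n else if i == n :> nat then n.-1 else i) :> nat.
Proof.
rewrite /D_sigma permE /= -!(inj_eq val_inj) /= val_fork.
by do 2?case: ifP => //; rewrite val_fork.
Qed.

Lemma sigma_diagram : is_diagram_perm (D n) (D_sigma n).
Proof.
move=> i j; rewrite !(D_entryE gt2n) (inj_eq (@perm_inj _ (D_sigma n))).
case: eqVneq => // neq_ij; congr (if _ then _ else _).
have lti := leq_ord i; have ltj := leq_ord j.
have : i <> j :> nat by move/val_inj; apply/eqP.
rewrite !val_sigma /dadj.
case: (nat_of_ord i =P n.-1) => [->|?]; case: (nat_of_ord j =P n.-1) => [->|?].
all: try case: (nat_of_ord i =P n) => [->|?]; try case: (nat_of_ord j =P n) => [->|?].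
all: lia.
Qed.

(** No edge jumps over an index up to [n.-2], so removing it separates smaller indices from larger
    ones. Index [n.-1] is jumped over by the edge to the last index, whence the bound. *)
Lemma connected_between X i j z :
  connected_subset (D n) X -> i \in X -> j \in X ->
  i < z < j -> z <= n.-2 -> z \in X.
Proof.
move=> cX iX jX /andP[ltiz ltzj] lez; apply/negPn/negP => zX.
have /connectP[p pp ej] := cX i j iX jX; move: ltzj; rewrite ej.
apply/negP; rewrite -leqNgt ltnW // {ej}.
elim: p i ltiz pp {iX} => [|k p IHp] i ltiz //= /andP[/and3P[iX kX adj] pp].
apply: (IHp k) => //.
have neq : k <> z :> nat by move/val_inj => ekz; rewrite -ekz kX in zX.
move: adj; rewrite /cox_adj /= -[D_entry i k]/(D n i k) (D_entryE gt2n).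
case: (eqVneq i k) => [<- _ //|_]; case: ifP => // + _.
by rewrite /dadj; have := leq_ord k; lia.
Qed.

End DDiagram.

(** * The homomorphisms from B2 to type D and their classification *)

Section Classification.
Variable n : nat.
Hypothesis gt3n : 3 < n.
Implicit Types (i j z : 'I_n.+1) (A B : {set 'I_n.+1}) (e f : hecke (D n)).

Let gt2n : 2 < n := ltnW gt3n.
Local Notation mod := (D_model gt2n).

Lemma admissibleE k : admissible n k =
  (2 <= k <= n) && (k.-1 <= (n.+2 - k)./2.*2).
Proof. rewrite /admissible /ceil_divn; lia. Qed.

Lemma factors_intervals A B e f :
  hzero A e -> hzero B f -> A :|: B = [set: 'I_n.+1]%SET ->
  connected_subset (D n) A -> connected_subset (D n) B ->
  hzero [set: 'I_n.+1]%SET (f * e * f * e) ->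
  ~ hzero [set: 'I_n.+1]%SET f ->
  inord n.-1 \in A -> ord_max \notin A ->
  A = interval n.+1 1 n /\ exists2 k, admissible n k & B = interval n.+1 k n.+1.
Proof.
move=> eA fB AB cA cB top nf forkA lastA.
have forkE := val_fork gt2n.
have inAB z : (z \in A) || (z \in B) by rewrite -finset.in_setU AB inE.
have lastB : ord_max \in B by have := inAB ord_max; rewrite (negPf lastA).
have lowA : A \subset D_low n.
  apply/fintype.subsetP => z zA; rewrite inE ltn_neqAle leq_ord andbT.
  by apply: contraNneq lastA => ez; rewrite (_ : ord_max = z) //; apply: val_inj.
(* Otherwise [A] and [B] each miss one end of the fork, and [type_A_not_zero] applies. *)
have forkB : inord n.-1 \in B.
  apply/negPn/negP => nforkB.
  apply: (type_A_not_zero gt2n gt3n lowA _ (proj1 eA) (proj1 fB) top) => z zB.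
  apply: contraNneq nforkB => ez; rewrite (_ : inord _ = z) //.
  by apply: val_inj; rewrite /= forkE.
have exB : exists m : nat, [exists z in B, z == m :> nat].
  by exists n; apply/existsP; exists ord_max; rewrite lastB /=.
case: (ex_minnP exB) => m /existsP[zm /andP[mB /eqP ezm]] minm.
have {}minm z : z \in B -> m <= z.
  by move=> zB; apply: minm; apply/existsP; exists z; rewrite zB /=.
have lem : m <= n.-1 by rewrite -forkE; apply: minm.
have B_int z : (z \in B) = (m <= z).
  apply/idP/idP => [|lemz]; first exact: minm.
  have [ez|neq] := eqVneq (z : nat) m.
    by rewrite (_ : z = zm) //; apply: val_inj; rewrite /= ezm.
  have [lez|gtz] := leqP z n.-2.
    have bz : zm < z < (ord_max : 'I_n.+1) by rewrite /= ezm; lia.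
    exact: (connected_between gt2n cB mB lastB bz lez).
  have [ez|ez] : z = n.-1 :> nat \/ z = n :> nat by have := leq_ord z; lia.
    by rewrite (_ : z = inord n.-1) //; apply: val_inj; rewrite /= forkE.
  by rewrite (_ : z = ord_max) //; apply: val_inj.
(* If [B] contained the first index it would be the whole set, and [f] the top element, against
   [nf]. *)
have m_gt0 : 0 < m.
  rewrite lt0n; apply/eqP => m0; case: nf.
  by rewrite (_ : [set: _]%SET = B) //; apply/setP => z; rewrite inE B_int m0.
have zeroA : ord0 \in A.
  by have := inAB ord0; rewrite B_int leqNgt m_gt0 orbF.
have A_int : A = interval n.+1 1 n.
  apply/setP => z; rewrite inE /=; apply/idP/idP => [|ltzn].
    by move/(fintype.subsetP lowA); rewrite inE.
  have [ez|neq] := eqVneq (z : nat) 0.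
    by rewrite (_ : z = ord0) //; apply: val_inj.
  have [lez|gtz] := leqP z n.-2.
    have bz : (ord0 : 'I_n.+1) < z < (inord n.-1 : 'I_n.+1).
      by rewrite forkE /=; lia.
    exact: (connected_between gt2n cA zeroA forkA bz lez).
  by rewrite (_ : z = inord n.-1) //; apply: val_inj; rewrite /= forkE; lia.
split=> //; exists m.+1; last first.
  by apply/setP => z; rewrite inE B_int; have := ltn_ord z; lia.
have B_int' : B = interval n.+1 m.+1 n.+1.
  by apply/setP => z; rewrite inE B_int; have := ltn_ord z; lia.
rewrite admissibleE; rewrite A_int in eA; rewrite B_int' in fB.
have lk : 2 <= m.+1 <= n by lia.
by rewrite lk /=; apply/(fefe_zero gt2n lk eA fB).
Qed.

Section Construction.
Variable k : nat.
Hypothesis adm : admissible n k.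

Local Notation e := (to_hecke (w0 (D n) (interval n.+1 1 n))).
Local Notation f := (to_hecke (w0 (D n) (interval n.+1 k n.+1))).
Local Notation a := (ord0 : 'I_2).
Local Notation b := (ord_max : 'I_2).

Let k2n : 2 <= k <= n.
Proof. by move: adm; rewrite admissibleE => /andP[]. Qed.
Let e0 := hzero_w0 mod (interval n.+1 1 n).
Let f0 := hzero_w0 mod (interval n.+1 k n.+1).

Let fefe0 : hzero [set: 'I_n.+1]%SET (f * e * f * e).
Proof.
by apply/(fefe_zero gt2n k2n e0 f0); move: adm; rewrite admissibleE => /andP[].
Qed.

(** A zero is fixed by reversal, and so are [e] and [f]; reversing [fefe] gives [efef]. *)
Let efef : e * f * e * f = f * e * f * e.
Proof.
have [u eu] : exists u, hclass (D n) u = e by exists (repr e); apply: hclassE.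
have [v ev] : exists v, hclass (D n) v = f by exists (repr f); apply: hclassE.
have ru : hclass (D n) (rev u) = e by have := e0; rewrite -eu => /hzero_rev.
have rv : hclass (D n) (rev v) = f by have := f0; rewrite -ev => /hzero_rev.
have : hzero [set: 'I_n.+1]%SET (hclass (D n) (v ++ u ++ v ++ u)).
  by rewrite -!hclassM eu ev !mulgA.
move/hzero_rev; rewrite !rev_cat -!hclassM ru rv eu ev !mulgA.
by [].
Qed.

Lemma B2_D_hom_exists :
  exists phi : hecke B2 -> hecke (D n), is_B2_D_hom k phi.
Proof.
pose c (i : 'I_2) := if i == a then e else f.
have [|i j neq_ij _|phi mphi phiE] := @hecke_lift _ B2 (hecke (D n)) c.
- move=> i; rewrite /c; case: ifP => _.
    by have [] := hzero_mul e0 (proj1 e0).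
  by have [] := hzero_mul f0 (proj1 f0).
- have alt : wordval c (alternating a b 4) = wordval c (alternating b a 4).
    by rewrite /= !mulg1 !mulgA.
  rewrite /= /B2_entry (negPf neq_ij).
  by move: i j neq_ij; elim/I2_case; elim/I2_case.
by exists phi; split; rewrite ?phiE.
Qed.

Variable phi : hecke B2 -> hecke (D n).
Hypothesis phi_hom : is_B2_D_hom k phi.

Let mphi : monoid_morphism phi. Proof. by case: phi_hom. Qed.
Let phi_a : phi (hgen B2 a) = e. Proof. by case: phi_hom. Qed.
Let phi_b : phi (hgen B2 b) = f. Proof. by case: phi_hom. Qed.

Let phi_aba : phi (hclass B2 [:: a; b; a]) = e * f * e.
Proof. by rewrite morphism_hclass //= phi_a phi_b mulg1 !mulgA. Qed.

Let phi_bab : phi (hclass B2 [:: b; a; b]) = f * e * f.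
Proof. by rewrite morphism_hclass //= phi_a phi_b mulg1 !mulgA. Qed.

Let phi_top : phi (hclass B2 [:: a; b; a; b]) = f * e * f * e.
Proof. by rewrite morphism_hclass //= phi_a phi_b mulg1 -efef !mulgA. Qed.

Lemma B2_D_hom_injective : injective phi <-> ~ (~~ odd n /\ k = 2).
Proof.
rewrite -(efe_zero gt2n k2n e0 f0); split=> [inj efe0|nefe].
  by apply: B2_aba_neq; apply: inj; rewrite phi_aba phi_top; apply: hzero_uniq efe0 _.
apply: B2_injective => //; rewrite phi_top.
  by rewrite phi_aba => eq_top; apply: nefe; rewrite eq_top.
rewrite phi_bab => eq_top; apply: (fef_not_zero gt2n k2n e0 f0).
by rewrite eq_top.
Qed.

Lemma B2_D_hom_parabolic : k = 2 -> hecke_parabolic phi.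
Proof.
move=> k2 K' _; split=> [|J' sJ'K']; first exact: (spherical_model mod).
have phi_w0 K : phi (to_hecke (w0 B2 K)) = to_hecke (w0 (D n) (hsupps phi K)).
  apply: hzero_uniq (hzero_w0 mod _).
  exact: (hzero_hsupps mod mphi (hzero_w0 B2_model K)).
have [J0|nJ0] := eqVneq J' finset.set0.
  exists finset.set0; first exact: finset.sub0set.
  by rewrite /wpair J0 (w0_set0 B2_model) (w0_set0 mod) !mul1g phi_w0.
have [JK|nJK] := eqVneq J' K'.
  exists (hsupps phi K') => //.
  rewrite /wpair JK (w0_sqr B2_model) (w0_sqr mod).
  have to1 (I : finType) (M : coxeterMatrix I) (G : finGroupType) (g : I -> G)
      D (m : descent_model M g D) : to_hecke (1 : coxeter M) = 1.
    exact: (to_hecke_cclass m (@greduced_nil I G g)).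
  by rewrite (to1 _ _ _ _ _ mod) (to1 _ _ _ _ _ B2_model); case: mphi.
have [KT Jab] := I2_subsets sJ'K' nJ0 nJK.
have suppT : hsupps phi K' = [set: 'I_n.+1]%SET.
  apply/setP => i; rewrite [RHS]inE; apply/finset.bigcupP.
  exists (if i < n then a else b); first by rewrite KT inE.
  rewrite /hsupp; case: (ltnP i n) => [ltin|gein].
    by rewrite phi_a (hzero_support mod e0) inE.
  by rewrite phi_b (hzero_support mod f0) inE; have := ltn_ord i; lia.
have w0T : hzero [set: 'I_n.+1]%SET (to_hecke (w0 (D n) [set: 'I_n.+1]%SET)).
  exact: hzero_w0 mod _.
rewrite suppT KT.
case: Jab => [Ja|Jb].
(* By [gen_first_fef], [fef] is [s_1] times the longest element in the Coxeter group. *)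
- exists (finset.set1 ord0); first exact: finset.subsetT.
  rewrite Ja wpair_B2_a phi_bab /wpair (w0_set1 mod).
  symmetry; apply: (to_hecke_cgenM mod).
    exact: hzero_uniq (gen_first_fef gt2n k2n e0 f0 k2) w0T.
  by move=> eq_top; apply: (fef_not_zero gt2n k2n e0 f0); rewrite eq_top.
(* For even [n], [efe] is itself the longest element and [J] is empty; for odd [n], [gen_last_efe]
   leads to the index [n + 1]. *)
have [oddn|evn] := boolP (odd n); last first.
  exists finset.set0; first exact: finset.subsetT.
  rewrite Jb wpair_B2_b phi_aba /wpair (w0_set0 mod) mul1g.
  by apply: hzero_uniq w0T; apply/(efe_zero gt2n k2n e0 f0).
exists (finset.set1 ord_max); first exact: finset.subsetT.
rewrite Jb wpair_B2_b phi_aba /wpair (w0_set1 mod).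
symmetry; apply: (to_hecke_cgenM mod).
  exact: hzero_uniq (gen_last_efe gt2n k2n e0 f0 k2 oddn) w0T.
move=> eq_top; have [] : ~~ odd n /\ k = 2; last by rewrite oddn.
by apply/(efe_zero gt2n k2n e0 f0); rewrite eq_top.
Qed.

End Construction.

Lemma B2_D_hom_classification (phi : hecke B2 -> hecke (D n)) :
  monoid_morphism phi -> injective phi -> hecke_connected phi ->
  fully_supported phi -> ~ sigma_invariant phi ->
  exists (k : nat) (psi : hecke B2 -> hecke (D n))
         (theta' : hecke B2 -> hecke B2) (theta : hecke (D n) -> hecke (D n)),
    [/\ admissible n k,
        is_B2_D_hom k psi,
        is_diagram_automorphism theta',
        is_diagram_automorphism theta &
        forall x, phi x = theta (psi (theta' x))].
Proof.
move=> mphi inj conn full nsigma.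
have [i ni] : exists i : 'I_2, (D_sigma n @: hsupp phi i)%SET <> hsupp phi i.
  by apply: contra_notP nsigma => ne i; apply: contra_notP ne; exists i.
pose fork : 'I_n.+1 := inord n.-1; have forkE : fork = n.-1 :> nat := val_fork gt2n.
have sigmaK : involutive (D_sigma n) by apply: tpermK.
have mem_sigma z : (z \in D_sigma n @: hsupp phi i)%SET = (D_sigma n z \in hsupp phi i).
  by rewrite -{1}[z]sigmaK mem_imset //; apply: perm_inj.
(* [D_sigma] moves only the two ends of the fork, so a support that it does not preserve contains
   exactly one of them. *)
have sep : (fork \in hsupp phi i) != (ord_max \in hsupp phi i).
  apply: contra_notN ni => /eqP efork; apply/setP => z; rewrite mem_sigma.
  by rewrite /D_sigma; case: tpermP => [->|->|//]; rewrite -/fork efork.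
(* [tau] brings this end to the index [n], and [tau'] makes [i] the first generator. *)
pose tau : {perm 'I_n.+1} := if fork \in hsupp phi i then 1 else D_sigma n.
pose tau' : {perm 'I_2} := tperm ord0 i.
have tauK : involutive tau.
  by rewrite /tau; case: ifP => _ z; rewrite ?sigmaK ?perm1.
have tau'K : involutive tau' by apply: tpermK.
have tauD : is_diagram_perm (D n) tau.
  rewrite /tau; case: ifP => _; last exact: sigma_diagram gt2n.
  by move=> z t; rewrite !perm1.
have [theta autotheta thetaE] := hecke_diagram tauD.
have [theta' autotheta' theta'E] := hecke_diagram (@B2_diagram tau').
have thetaK : involutive theta.
  by move=> h; rewrite -[h]hclassE !thetaE -map_comp map_id_in // => z _ /=; apply: tauK.
pose j : 'I_2 := tau' ord_max.
have tau'a : tau' ord0 = i by rewrite tpermL.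
pose A := (tau @: hsupp phi i)%SET; pose B := (tau @: hsupp phi j)%SET.
have mem_tau z (X : {set 'I_n.+1}) : (z \in tau @: X)%SET = (tau z \in X).
  by rewrite -{1}[z]tauK mem_imset //; apply: perm_inj.
have A0 : hzero A (theta (phi (hgen B2 i))).
  exact/(hzero_diagram thetaE)/(hzero_hsupp mod).
have B0 : hzero B (theta (phi (hgen B2 j))).
  exact/(hzero_diagram thetaE)/(hzero_hsupp mod).
have connX l : connected_subset (D n) (tau @: hsupp phi l)%SET.
  apply: connected_diagram => //.
  have -> : hsupp phi l = hsupps phi (finset.set1 l) by rewrite /hsupps big_set1.
  apply: conn => k1 k2; rewrite !inE => /eqP-> /eqP->; exact: connect0.
have AB : A :|: B = [set: 'I_n.+1]%SET.
  apply/setP => z; rewrite finset.in_setU !mem_tau [RHS]inE.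
  have : tau z \in hsupps phi [set: 'I_2]%SET by rewrite full inE.
  case/finset.bigcupP => l _; rewrite -[l]tau'K; move: (tau' l); elim/I2_case.
    by rewrite tau'a => ->.
  by move=> ->; rewrite orbT.
have mtheta : monoid_morphism theta by case: autotheta.
have mtheta' : monoid_morphism theta' by case: autotheta'.
have zeroT h : hzero [set: 'I_2]%SET h -> hzero [set: 'I_n.+1]%SET (theta (phi h)).
  move=> /(hzero_hsupps mod mphi); rewrite full => /(hzero_diagram thetaE).
  by congr hzero; apply/setP => z; rewrite mem_tau !inE.
have jiji : hzero [set: 'I_2]%SET (hclass B2 [:: j; i; j; i]).
  have := hzero_diagram theta'E B2_zero; rewrite theta'E /= tau'a -/j => ijij.
  have := hzero_rev ijij => /= jiji; rewrite -[hclass _ _]jiji in ijij.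
  move: ijij; congr hzero; apply/setP => l.
  by rewrite -[l]tau'K mem_imset ?inE //; apply: perm_inj.
have top : hzero [set: 'I_n.+1]%SET (theta (phi (hgen B2 j)) *
    theta (phi (hgen B2 i)) * theta (phi (hgen B2 j)) * theta (phi (hgen B2 i))).
  have [_ thetaM] := mtheta; have [_ phiM] := mphi.
  have := zeroT _ jiji.
  rewrite -[hclass _ _]/(hclass B2 ([:: j] ++ [:: i] ++ [:: j] ++ [:: i])).
  by rewrite -!hclassM !phiM !thetaM !mulgA.
(* Otherwise injectivity would identify the generator [j] with the top, whose support contains
   [i]. *)
have nB : ~ hzero [set: 'I_n.+1]%SET (theta (phi (hgen B2 j))).
  move=> /(hzero_uniq (zeroT _ jiji))/(can_inj thetaK)/inj/hclass_mem/(_ i).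
  rewrite !inE eqxx !orbT => /esym/eqP; rewrite -tau'a => /perm_inj.
  by [].
have [||A_int [k adm B_int]] :=
    factors_intervals A0 B0 AB (connX i) (connX j) top nB.
- rewrite mem_tau /tau; case: ifP; rewrite -/fork ?perm1 //.
  by rewrite tpermL => nfork; move: sep; rewrite nfork; case: (_ \in _).
- rewrite mem_tau /tau; case: ifP => nfork; move: sep; rewrite nfork ?perm1.
    by case: (_ \in _).
  by rewrite tpermR -/fork nfork.
have [psi psi_hom] := B2_D_hom_exists adm.
exists k, psi, theta', theta; split => //.
have [mpsi psia psib] := psi_hom.
have mcomp : monoid_morphism (theta \o psi \o theta').
  have [t1 tM] := mtheta; have [p1 pM] := mpsi; have [t1' tM'] := mtheta'.
  split; first by rewrite /= t1' p1 t1.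
  by move=> x y; rewrite /= tM' pM tM.
apply: (morphism_eq mphi mcomp) => l; rewrite /= theta'E /=.
rewrite -[phi _]thetaK -{1}[l]tau'K; congr theta; move: (tau' l).
(* On each generator the two images are zeros of the same parabolic submonoid. *)
elim/I2_case; rewrite -/(hgen B2 _) ?psia ?psib ?tau'a.
  by apply: hzero_uniq A0 _; rewrite A_int; apply: hzero_w0 mod _.
by apply: hzero_uniq B0 _; rewrite B_int; apply: hzero_w0 mod _.
Qed.

End Classification.

Theorem proposition5p15 (n : nat) (hn : 4 <= n) :
  (forall k : nat, admissible n k ->
     exists phi : hecke B2 -> hecke (D n),
       [/\ is_B2_D_hom k phi,
           injective phi <-> ~ (~~ odd n /\ k = 2) &
           k = 2 -> hecke_parabolic phi])
  /\
  (forall phi : hecke B2 -> hecke (D n),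
     monoid_morphism phi -> injective phi -> hecke_connected phi ->
     fully_supported phi -> ~ sigma_invariant phi ->
     exists (k : nat) (psi : hecke B2 -> hecke (D n))
            (theta' : hecke B2 -> hecke B2) (theta : hecke (D n) -> hecke (D n)),
       [/\ admissible n k,
           is_B2_D_hom k psi,
           is_diagram_automorphism theta',
           is_diagram_automorphism theta &
           forall x, phi x = theta (psi (theta' x))]).
Proof.
split=> [k adm|]; last exact: B2_D_hom_classification.
have [phi phi_hom] := B2_D_hom_exists hn adm.
exists phi; split => //; first exact: B2_D_hom_injective adm _ phi_hom.
exact: B2_D_hom_parabolic adm _ phi_hom.
Qed.
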